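(* Let $M$ be a compact oriented $n$-manifold with (embedded ordinary) faces and let $(\mathcal Y,\omega_{\mathcal Y}=\mathrm d_{\mathcal Y}\alpha_{\mathcal Y},\mathsf Q_{\mathcal Y},\Theta)$ be an exact Hamiltonian dg symplectic target of AKSZ degree $n-1$. Under the formal mapping-space hypothesis, the assignment $$F\longmapsto(\mathcal F_F,\omega_F,\alpha_F,S_F,\mathsf Q_F)$$ to all oriented faces $F\subseteq M$ has the following properties. (i) If $F$ has codimension $r$, then $\omega_F$ is closed ($\delta\omega_F=0$), $|\omega_F|=r-1$, and $|S_F|=r$. (ii) The failure of $\mathsf Q_F$ to be Hamiltonian is exactly the signed sum of the pullbacks of the primitives from the codimension-one faces of $F$: for every face $F$ of dimension $m$, $$\iota_{\mathsf Q_F}\omega_F=(-1)^m\delta S_F+\sum_{G\prec F}[F:G]\,\rho_{FG}^*\alpha_G .$$ (iii) Restriction to faces intertwines the cohomological vector fields: $T\rho_{FG}(\mathsf Q_F)=\mathsf Q_G$ whenever $G\prec F$. (iv) Factorially normalized facewise transgression $\chi\mapsto\mathbf T(\chi)$, $\mathbf T(\chi)_F^k=\frac1{k!}\mathsf T_F^k\chi$, is a cochain map from the target de Rham complex $(\Omega^\bullet(\mathcal Y),\mathrm d_{\mathcal Y})$ to the face total complex $(\mathcal C^\bullet(M,\mathcal Y),\mathbf D)$. (v) The twice-iterated defect vanishes, because the signed face differential squares to zero: for every face $F$ and every codimension-two face $H$ of $F$, $$\sum_{G:\,H\prec G\prec F}[F:G][G:H]\,(\rho_{GH}\circ\rho_{FG})^*\alpha_H=0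 .$$ (vi) If $F$ is closed (has no codimension-one faces), has codimension $r$, and $\omega_F$ is nondegenerate, then the face data form a strict $\mathrm{BF}^r\mathrm V$ theory.
   Context: Manifolds with faces. A compact $n$-dimensional manifold with faces is a compact smooth manifold with corners $M$ (local models $[0,\infty)^r\times\mathbb R^{n-r}$) in which every boundary hypersurface is embedded. A face is the closure of a connected stratum; $\mathfrak F_r(M)$ is the (finite) set of codimension-$r$ faces and $\mathfrak F(M)=\coprod_r\mathfrak F_r(M)$ (if $M$ is connected, $M$ itself is the face of codimension zero). Every face is again a manifold with faces. Orientations of all faces are fixed once and for all, that of $M$ being the given one. $G\prec F$ means that $G$ is a codimension-one face of the face $F$; $[F:G]\in\{+1,-1\}$ compares the orientation of $G$ induced from $F$ by the outward-normal-first convention with the fixed orientation of $G$. Target. An exact Hamiltonian dg symplectic target of AKSZ degree $n-1$ is $(\mathcal Y,\omega_{\mathcal Y}=\mathrm d_{\mathcal Y}\alpha_{\mathcal Y},\mathsf Q_{\mathcal Y},\Theta)$ with $\mathcal Y$ a graded manifold, $\omega_{\mathcal Y}$ a symplectic two-form of internal degree $n-1$, $\mathsf Q_{\mathcal Y}$ a degree-$1$ cohomological vector field, $\iota_{\mathsf Q_{\mathcal Y}}\omega_{\mathcal Y}=\mathrm d_{\mathcal Y}\Theta$ with $\Theta$ of degree $n$, and $\{\Theta,\Theta\}_{\mathcal Y}=0$. Formal mapping-space hypothesis. For every face $F$ the graded mapping space $\mathcal F_F=\mathrm{Map}(T[1]F,\mathcal Y)$ admits the evaluation map, restriction maps, contractions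 by the lifted source and target vector fields, and fiber integration of local forms, and these operations satisfy graded Cartan calculus and Stokes' formula. Formulas are read as identities between local functionals and local field-space forms (or on a regular finite-dimensional approximation where the fiber integrals and pullbacks are defined). Mapping-space data. Let $m=\dim F$. $\mathrm{ev}_F:\mathcal F_F\times T[1]F\to\mathcal Y$ is evaluation, $p_F:\mathcal F_F\times T[1]F\to\mathcal F_F$ the projection, $(p_F)_*$ Berezin fiber integration (of degree $-m$), $\rho_{FG}:\mathcal F_F\to\mathcal F_G$ restriction of maps, $\delta$ the de Rham differential on field space, $|\cdot|$ internal degree. $D_F$ is the source de Rham vector field on $T[1]F$, $\widehat D_F$ its lift to $\mathcal F_F$ by precomposition, $\check{\mathsf Q}_{\mathcal Y}$ the lift of $\mathsf Q_{\mathcal Y}$ by postcomposition, and $\mathsf Q_F=\widehat D_F+\check{\mathsf Q}_{\mathcal Y}$. For $\chi\in\Omega^p(\mathcal Y)$: $\mathsf T_F^0\chi=(p_F)_*\mathrm{ev}_F^*\chi$ and $\mathsf T_F^k\chi=\iota_{\widehat D_F}^{\,k}\mathsf T_F^0\chi$. Set $\omega_F=\mathsf T_F^0(\omega_{\mathcal Y})$, $\alpha_F=\mathsf T_F^0(\alpha_{\mathcal Y})$, $S_F=\mathsf T_F^1(\alpha_{\mathcal Y})+\mathsf T_F^0(\Theta)$. Sign conventions: $\delta\circ(p_F)_*=(-1)^m(p_F)_*\circ\delta$; the source de Rham differential and $\delta$ anticommute; for a degree-one vector field $V$, $\iota_V$ is an even derivation and $\mathcal L_V=\iota_V\delta-\delta\iota_V$;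 Stokes: integrating the source differential over $T[1]F$ gives $\sum_{G\prec F}[F:G]\rho_{FG}^*$ of the integral over $T[1]G$, with no further sign. Face total complex. $\mathcal C^p(M,\mathcal Y)$ consists of families $\eta=\{\eta_F^k\}_{F\in\mathfrak F(M),k\ge0}$ with $\eta_F^k\in\Omega^{p-k}(\mathcal F_F)$ (and $\Omega^q=0$ for $q<0$); with $\eta_F^{-1}=0$, $(\mathbf D\eta)_F^k=(-1)^{\dim F}\delta\eta_F^k+\sum_{G\prec F}[F:G]\rho_{FG}^*\eta_G^{k-1}$. Strict $\mathrm{BF}^r\mathrm V$ theory: $(\mathcal F_F,\omega_F,\mathsf Q_F,S_F)$ with $\omega_F$ closed and nondegenerate of degree $r-1$, $S_F$ of degree $r$, $\mathsf Q_F$ of degree $1$ with $\mathsf Q_F^2=0$, $\iota_{\mathsf Q_F}\omega_F=(-1)^{\dim F}\delta S_F$ (the global sign being a convention for the Hamiltonian), and the classical master equation $\{S_F,S_F\}_F=0$ for the Poisson bracket of $\omega_F$. Nondegeneracy is in the (weak) sense that $X\mapsto\iota_X\omega_F$ is injective on local vector fields. *)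

(* Defs.v *)
From HB Require Import structures.
From mathcomp Require Import all_boot all_order all_algebra.
From mathcomp Require Import all_classical all_reals all_analysis.

Set Implicit Arguments.
Unset Strict Implicit.
Unset Printing Implicit Defensive.

Import Order.TTheory GRing.Theory Num.Theory.
Import numFieldNormedType.Exports.

Local Open Scope classical_set_scope.
Local Open Scope ring_scope.

Section Smooth.
Context {R : realType}.

Definition iterD {U V : normedModType R} (vs : seq U) (f : U -> V) : U -> V :=
  foldr (fun v g x => 'D_v g x) f vs.

(* C^oo: all iterated directional derivatives exist and are continuous. *)
Definition smooth_on {U V : normedModType R} (A : set U) (f : U -> V) : Prop :=
  forall (vs : seq U) (x : U), A x ->
    (forall v, derivable (iterD vs f) x v) /\ {for x, continuous (iterD vs f)}.

Definition corner {n : nat} (r : nat) : set 'rV[R]_n :=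
  [set x | forall i : 'I_n, (i < r)%N -> 0 <= x 0 i].
End Smooth.

Record chart (R : realType) (n : nat) (T : Type) := Chart {
  cdom : set T;
  crank : nat;
  cmap : T -> 'rV[R]_n }.

Section Charts.
Context {R : realType} {n : nat} {M : topologicalType}.
Implicit Types c : chart R n M.

(* A homeomorphism of the open set [cdom c] onto a relatively open subset of
   [0,oo)^r x R^(n-r), with r = crank c. *)
Definition is_chart c : Prop :=
  [/\ (crank c <= n)%N, open (cdom c),
      {in cdom c &, injective (cmap c)},
      {within cdom c, continuous (cmap c)} &
      forall V : set M, open V -> V `<=` cdom c ->
        exists2 W : set 'rV[R]_n, open W &
          cmap c @` V = W `&` corner (crank c)].

(* g is a smooth extension to an open set W of R^n of the transition
   cmap c' \o (cmap c)^-1. *)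
Definition transition_ext c c' (W : set 'rV[R]_n) (g : 'rV[R]_n -> 'rV[R]_n) :=
  [/\ open W, smooth_on W g &
      forall z, cdom c z -> cdom c' z -> W (cmap c z) ->
        g (cmap c z) = cmap c' z].

Definition compatible c c' : Prop :=
  forall x, cdom c x -> cdom c' x ->
    exists W g, W (cmap c x) /\ transition_ext c c' W g.

Definition zeroset c (x : M) : {set 'I_n} :=
  [set i : 'I_n | (i < crank c)%N && (cmap c x 0 i == 0)]%SET.

Definition stratum_of (atlas : set (chart R n M)) (k : nat) : set M :=
  [set x | forall c, atlas c -> cdom c x -> #|zeroset c x| = k].

Definition is_face_of (atlas : set (chart R n M)) (k : nat) (F : set M) :=
  exists2 x, stratum_of atlas k x &
    F = closure (connected_component (stratum_of atlas k) x).

(* Near x, the set F is the coordinate sheet cut out by the vanishing of the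
   boundary coordinates in J. *)
Definition locally_cut c (x : M) (F : set M) (J : {set 'I_n}) : Prop :=
  J \subset zeroset c x /\
  \forall y \near x, F y <-> (forall j, j \in J -> cmap c y 0 j = 0).

(* A boundary hypersurface is embedded when it is locally a single sheet (it
   does not meet itself at a corner). *)
Definition embedded_hypersurface (atlas : set (chart R n M)) (F : set M) :=
  forall x c, F x -> atlas c -> cdom c x ->
    exists j : 'I_n, locally_cut c x F [set j]%SET.
End Charts.

Record manifold_with_faces (R : realType) (n : nat) := ManifoldWithFaces {
  mcar :> topologicalType;
  atlas : set (chart R n mcar);
  m_hausdorff : hausdorff_space mcar;
  m_compact : compact [set: mcar];
  atlas_chart : forall c, atlas c -> is_chart c;
  atlas_cover : forall x, exists2 c, atlas c & cdom c x;
  atlas_compatible : forall c c', atlas c -> atlas c' -> compatible c c';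
  m_embedded : forall F, is_face_of atlas 1 F -> embedded_hypersurface atlas F }.

Definition stratum (R : realType) n (M : manifold_with_faces R n) (k : nat) :
  set M := stratum_of (atlas (m := M)) k.
Arguments stratum {R n} M k.

Record face (R : realType) n (M : manifold_with_faces R n) := Face {
  fcodim : nat;
  fcar : set M;
  faceP : is_face_of (atlas (m := M)) fcodim fcar }.

HB.instance Definition _ (R : realType) n (M : manifold_with_faces R n) :=
  gen_eqMixin (face M).
HB.instance Definition _ (R : realType) n (M : manifold_with_faces R n) :=
  gen_choiceMixin (face M).

Section Faces.
Context {R : realType} {n : nat} {M : manifold_with_faces R n}.
Implicit Types (F G H : face M) (c : chart R n M) (x : M).

Definition fdim F : nat := (n - fcodim F)%N.

Definition prec G F : Prop := fcar G `<=` fcar F /\ fcodim G = (fcodim F).+1.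

(* T_x F in the coordinates of the chart c. *)
Definition tangent c x F (v : 'rV[R]_n) : Prop :=
  exists2 J : {set 'I_n}, locally_cut c x (fcar F) J & forall j, j \in J -> v 0 j = 0.

Definition is_frame c x F (s : seq 'rV[R]_n) : Prop :=
  [/\ size s = fdim F, free s & forall v, v \in s -> tangent c x F v].

(* An orientation of F: a sign on the frames of T_x F (x in F, expressed in any
   chart at x), alternating with the determinant, independent of the chart and
   locally constant in x. *)
Record orientation F := Orientation {
  oval :> chart R n M -> M -> seq 'rV[R]_n -> R;
  oval_sign : forall c x s, atlas c -> cdom c x -> fcar F x -> is_frame c x F s ->
    oval c x s = 1 \/ oval c x s = -1;
  oval_det : forall c x s (A : 'M[R]_(fdim F)),
    atlas c -> cdom c x -> fcar F x -> is_frame c x F s -> A \in unitmx ->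
    oval c x [seq \sum_(j < fdim F) A i j *: s`_j | i <- enum 'I_(fdim F)]
      = Num.sg (\det A) * oval c x s;
  oval_chart : forall c c' x s W g,
    atlas c -> atlas c' -> cdom c x -> cdom c' x -> fcar F x -> is_frame c x F s ->
    W (cmap c x) -> transition_ext c c' W g ->
    oval c' x [seq 'D_v g (cmap c x) | v <- s] = oval c x s;
  oval_near : forall c x s, atlas c -> cdom c x -> fcar F x -> is_frame c x F s ->
    \forall y \near x, fcar F y -> is_frame c y F s -> oval c y s = oval c x s }.

(* At a point of the open stratum of G, G < F, exactly one boundary coordinate
   does not vanish on T_x F; outward vectors have negative such coordinate. *)
Definition outward c x F (v : 'rV[R]_n) : Prop :=
  tangent c x F v /\ exists2 i, i \in zeroset c x & v 0 i < 0.

Definition induced_agrees F G (oF : orientation F) (oG : orientation G) :=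
  forall c x v s, atlas c -> cdom c x -> fcar G x -> stratum M (fcodim G) x ->
    outward c x F v -> is_frame c x G s -> oF c x (v :: s) = oG c x s.

Definition incidence (o : forall F, orientation F) F G : R :=
  if `[< induced_agrees (o F) (o G) >] then 1 else -1.

Definition fboundary F : set (face M) := [set G | prec G F].

Definition closed_face F : Prop := forall G, ~ prec G F.
End Faces.

Definition ksgn {R : realType} (i : int) : R := (-1) ^ i.

(* Z-graded-commutative unital associative R-algebras, presented by their
   homogeneous components. *)
Record galg (R : realType) := GAlg {
  gcar :> int -> lmodType R;
  gmul : forall g h k : int, g + h = k -> gcar g -> gcar h -> gcar k;
  gone : gcar 0;
  gmul_linl : forall g h k (e : g + h = k) a x y z,
    gmul e (a *: x + y) z = a *: gmul e x z + gmul e y z;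
  gmulC : forall g h k (e : g + h = k) (e' : h + g = k) x y,
    gmul e x y = ksgn (g * h) *: gmul e' y x;
  gmulA : forall g h i gh hi k (e1 : gh + i = k) (e2 : g + h = gh)
      (e3 : g + hi = k) (e4 : h + i = hi) x y z,
    gmul e1 (gmul e2 x y) z = gmul e3 x (gmul e4 y z);
  gmul1l : forall g (e : 0 + g = g) x, gmul e gone x = x }.

(* Graded derivations of degree d: the vector fields of degree d. *)
Record gder (R : realType) (A : galg R) (d : int) := GDer {
  dact : forall g k : int, d + g = k -> A g -> A k;
  dact_lin : forall g k (e : d + g = k) a x y,
    dact e (a *: x + y) = a *: dact e x + dact e y;
  dact_leibniz : forall g h i j k l (e : d + k = l) (e0 : g + h = k)
      (e1 : i + h = l) (e2 : d + g = i) (e3 : g + j = l) (e4 : d + h = j) x y,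
    dact e (gmul e0 x y)
      = gmul e1 (dact e2 x) y + ksgn (d * g) *: gmul e3 x (dact e4 y) }.

Section GradedForms.
Context {R : realType} {A : galg R}.

Lemma ksgnD (i j : int) : ksgn (i + j) = ksgn i * ksgn j :> R.
Proof. by rewrite /ksgn expfzDr // oppr_eq0 oner_eq0. Qed.

Lemma ksgnK (i : int) : ksgn i * ksgn i = 1 :> R.
Proof. by rewrite /ksgn -expfzMl mulrNN mulr1 exp1rz. Qed.

Local Lemma br_aux (V : lmodType R) (p q r : R) (u v w z t s : V) :
  p * p = 1 ->
  q *: (u + r *: w) + (v + (p * r) *: z)
    - p *: (r *: (z + q *: t) + (s + (p * q) *: u))
  = v - p *: s + (r * q) *: (w - p *: t).
Proof.
move=> pp; rewrite !(scalerDr, scalerN, scalerA, scalerBr, opprD).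
rewrite mulrA pp mul1r [q * r]mulrC [p * r * q]mulrAC -[p * q * r]mulrA.
rewrite [q * r]mulrC [p * (r * q)]mulrC.
rewrite (AC ((2*2)*(2*2)) (((1*8)*(4*5))*((3*7)*(2*6)))) /=.
by rewrite !subrr !add0r.
Qed.

Lemma gmul_linr g h k (e : g + h = k) a (x : A g) (y z : A h) :
  gmul e x (a *: y + z) = a *: gmul e x y + gmul e x z.
Proof.
have e' : h + g = k by rewrite addrC.
by rewrite (gmulC e e') gmul_linl scalerDr !scalerA mulrC -scalerA
   -!(gmulC e e').
Qed.

Lemma gmulBl g h k (e : g + h = k) a (x y : A g) (z : A h) :
  gmul e (x - a *: y) z = gmul e x z - a *: gmul e y z.
Proof. by rewrite addrC -scaleNr gmul_linl scaleNr addrC. Qed.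

Lemma gmulBr g h k (e : g + h = k) a (x : A g) (y z : A h) :
  gmul e x (y - a *: z) = gmul e x y - a *: gmul e x z.
Proof. by rewrite addrC -scaleNr gmul_linr scaleNr addrC. Qed.

Definition br_act g g' (X : gder A g) (Y : gder A g') j l
    (e : g + g' + j = l) (a : A j) : A l :=
  dact X (etrans (addrA g g' j) e) (dact Y (erefl (g' + j)) a)
  - ksgn (g * g') *:
    dact Y (etrans (addrCA g' g j) (etrans (addrA g g' j) e))
      (dact X (erefl (g + j)) a).

Lemma br_act_lin g g' (X : gder A g) (Y : gder A g') j l
    (e : g + g' + j = l) a (x y : A j) :
  br_act X Y e (a *: x + y) = a *: br_act X Y e x + br_act X Y e y.
Proof.
rewrite /br_act !dact_lin scalerDr scalerBr opprD !scalerA [a * _]mulrC.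
by rewrite addrACA.
Qed.

Lemma br_act_leibniz g g' (X : gder A g) (Y : gder A g')
    i h i' j k l (e : g + g' + k = l) (e0 : i + h = k) (e1 : i' + h = l)
    (e2 : g + g' + i = i') (e3 : i + j = l) (e4 : g + g' + h = j)
    (x : A i) (y : A h) :
  br_act X Y e (gmul e0 x y)
  = gmul e1 (br_act X Y e2 x) y
    + ksgn ((g + g') * i) *: gmul e3 x (br_act X Y e4 y).
Proof.
rewrite /br_act.
have eYx : g' + i + h = g' + k by rewrite -addrA e0.
have exY : i + (g' + h) = g' + k by rewrite addrCA e0.
have eXx : g + i + h = g + k by rewrite -addrA e0.
have exX : i + (g + h) = g + k by rewrite addrCA e0.
have eXY : g + i + (g' + h) = l by rewrite addrACA e0.
have eYX : g' + i + (g + h) = l by rewrite addrACA [g' + g]addrC e0.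
rewrite (dact_leibniz _ _ e0 eYx erefl exY erefl).
rewrite (dact_leibniz _ _ e0 eXx erefl exX erefl).
rewrite [_ + ksgn _ *: _]addrC [X in _ - _ *: dact _ _ X]addrC !dact_lin.
rewrite (dact_leibniz _ (etrans (addrA g g' k) e) exY eXY erefl e3
  (etrans (addrA g g' h) e4)).
rewrite (dact_leibniz _ (etrans (addrA g g' k) e) eYx e1
  (etrans (addrA g g' i) e2) eYX erefl).
rewrite (dact_leibniz _ _ exX eYX erefl e3
  (etrans (addrCA g' g h) (etrans (addrA g g' h) e4))).
rewrite (dact_leibniz _ _ eXx e1
  (etrans (addrCA g' g i) (etrans (addrA g g' i) e2)) eXY erefl).
rewrite gmulBl gmulBr !mulrDr !mulrDl !ksgnD [g' * g]mulrC.
exact: br_aux (ksgnK _).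
Qed.

Definition gbr g g' (X : gder A g) (Y : gder A g') : gder A (g + g') :=
  GDer (@br_act_lin _ _ X Y) (@br_act_leibniz _ _ X Y).
End GradedForms.

(** Differential p-forms of internal degree h over A, as graded-antisymmetric
    A-multilinear maps on vector fields, curried: [chi g k e X] is the
    contraction of chi with X.  Koszul signs are those of the total degree
    (form degree plus internal degree): d has degree 1, the contraction with X
    has degree |X| - 1 and the Lie derivative along X has degree |X|. *)
Fixpoint gform {R : realType} (A : galg R) (p : nat) (h : int) : Type :=
  match p with
  | 0%N => A h
  | p'.+1 => forall g k : int, g + h = k -> gder A g -> gform A p' k
  end.

Section FormCalculus.
Context {R : realType} {A : galg R}.

Definition fiota p h g k (e : g + h = k) (X : gder A g)
  (chi : gform A p.+1 h) : gform A p k := chi g k e X.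

Fixpoint fzero p : forall h, gform A p h :=
  match p with
  | 0%N => fun h => 0
  | p'.+1 => fun h g k e X => fzero p' k
  end.

Fixpoint fcomb (a b : R) p : forall h, gform A p h -> gform A p h -> gform A p h :=
  match p with
  | 0%N => fun h x y => a *: x + b *: y
  | p'.+1 => fun h x y g k e X => fcomb a b (x g k e X) (y g k e X)
  end.

Fixpoint fscale (a : R) p : forall h, gform A p h -> gform A p h :=
  match p with
  | 0%N => fun h x => a *: x
  | p'.+1 => fun h x g k e X => fscale a (x g k e X)
  end.

Lemma fmul_subproof (a g h k l : int) :
  a + h = k -> g + k = l -> a + (g + h) = l.
Proof. by move=> <- <-; rewrite addrCA. Qed.

(* Product of a function of degree a with a form:
   iota_X (f chi) = (-1)^(a(|X|-1)) f iota_X chi. *)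
Fixpoint fmul p : forall a h k, a + h = k -> A a -> gform A p h -> gform A p k :=
  match p with
  | 0%N => fun a h k e f x => gmul e f x
  | p'.+1 => fun a h k e f chi g l e' X =>
      fscale (ksgn (a * (g - 1)))
        (fmul (fmul_subproof e e') f (chi g (g + h) erefl X))
  end.

Lemma flie_subproof1 (g h k g' k' : int) :
  g + h = k -> g' + k = k' -> g + (g' + h) = k'.
Proof. by move=> <- <-; rewrite addrCA. Qed.

Lemma flie_subproof2 (g h k g' k' : int) :
  g + h = k -> g' + k = k' -> g + g' + h = k'.
Proof. by move=> <- <-; rewrite -addrA addrCA. Qed.

(* Lie derivative, from [L_X, iota_Y] = iota_[X,Y]. *)
Fixpoint flie p :
    forall g h k, g + h = k -> gder A g -> gform A p h -> gform A p k :=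
  match p with
  | 0%N => fun g h k e X f => dact X e f
  | p'.+1 => fun g h k e X chi g' k' e' Y =>
      fcomb (ksgn (g * (g' - 1))) (- ksgn (g * (g' - 1)))
        (flie (flie_subproof1 e e') X (chi g' (g' + h) erefl Y))
        (chi (g + g') k' (flie_subproof2 e e') (gbr X Y))
  end.

(* De Rham differential, from L_X = iota_X d + (-1)^|X| d iota_X. *)
Fixpoint fd p : forall h, gform A p h -> gform A p.+1 h :=
  match p with
  | 0%N => fun h f g k e X => dact X e f
  | p'.+1 => fun h chi g k e X =>
      fcomb 1 (- ksgn g) (flie e X chi) (fd (chi g k e X))
  end.

(* Additivity and A-linearity in the first argument: the condition on Z says
   Z = f X + Y. *)
Definition ftensorial p h (chi : gform A p.+1 h) : Prop :=
  forall a b g k l (eg : a + b = g) (ek : g + h = k) (el : b + h = l)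
    (em : a + l = k) (f : A a) (X : gder A b) (Y Z : gder A g),
    (forall i j m (e : g + i = j) (e1 : b + i = m) (e2 : a + m = j) (x : A i),
       dact Z e x = gmul e2 f (dact X e1 x) + dact Y e x) ->
    chi g k ek Z = fcomb 1 1 (fmul em f (chi b l el X)) (chi g k ek Y).

Definition fsymmetric p h (chi : gform A p.+2 h) : Prop :=
  forall g1 g2 k1 k2 k (e1 : g1 + h = k1) (e2 : g2 + h = k2)
    (e12 : g2 + k1 = k) (e21 : g1 + k2 = k) (X1 : gder A g1) (X2 : gder A g2),
    chi g1 k1 e1 X1 g2 k e12 X2
      = fscale (ksgn ((g1 - 1) * (g2 - 1))) (chi g2 k2 e2 X2 g1 k e21 X1).

Fixpoint is_form p : forall h, gform A p h -> Prop :=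
  match p with
  | 0%N => fun _ _ => True
  | p'.+1 => fun h chi =>
      [/\ forall g k e X, is_form (chi g k e X), ftensorial chi &
          match p' return gform A p'.+1 h -> Prop with
          | 0%N => fun _ => True
          | p''.+1 => fun chi => fsymmetric chi
          end chi]
  end.

Definition symplectic w (omega : gform A 2 w) : Prop :=
  [/\ is_form omega, fd omega = fzero 3 w,
      forall g k (e : g + w = k) (X X' : gder A g),
        fiota e X omega = fiota e X' omega ->
        forall i j (e' : g + i = j) (x : A i), dact X e' x = dact X' e' x &
      forall g k (e : g + w = k) (beta : gform A 1 k), is_form beta ->
        exists X : gder A g, fiota e X omega = beta].

(* h = {f, f'} = X_f f', where iota_{X_f} omega = d f and |X_f| = g. *)
Definition poisson_bracket w (omega : gform A 2 w) g a b c (e : g + w = a)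
    (e' : g + b = c) (f : A a) (f' : A b) (h : A c) : Prop :=
  exists2 X : gder A g, fiota e X omega = fd (f : gform A 0 a) & h = dact X e' f'.
End FormCalculus.

Section GradedChart.
Context {R : realType} {T : topologicalType} (O : set T -> galg R)
  (res : forall (U V : set T) (g : int), O U g -> O V g).

(* Exponents of monomials in graded generators xi_0, ..., xi_(q-1) of nonzero
   degrees w_0, ..., w_(q-1). *)
Definition admissible q (w : 'I_q -> int) (I : {ffun 'I_q -> nat}) : Prop :=
  forall a, odd `|w a|%N -> (I a <= 1)%N.

Definition mdegree q (w : 'I_q -> int) (I : {ffun 'I_q -> nat}) : int :=
  \sum_a w a *+ I a.

(* xi^I xi^J = msign w I J *: xi^(I+J) *)
Definition msign q (w : 'I_q -> int) (I J : {ffun 'I_q -> nat}) : R :=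
  \prod_(a < q) \prod_(b < q | (b < a)%N) ksgn ((w a * w b) *+ (I a * J b)%N).

(* Homogeneous elements of degree g of C^oo(W)[[xi_0, ..., xi_(q-1)]]. *)
Definition model_section d q (w : 'I_q -> int) (W : set 'rV[R]_d) (g : int)
    (c : {ffun 'I_q -> nat} -> 'rV[R]_d -> R) : Prop :=
  forall I, (admissible w I /\ mdegree w I = g ->
               smooth_on (V := R^o) W (c I)) /\
            (~ (admissible w I /\ mdegree w I = g) -> forall v, W v -> c I v = 0).

(* (phi, Phi) is an isomorphism from the graded ringed space (U, O) to an open
   subset of R^d with the sheaf of formal power series in the xi_a with smooth
   coefficients. *)
Definition graded_chart (U : set T) d q (w : 'I_q -> int) (phi : T -> 'rV[R]_d)
    (Phi : forall (V : set T) (g : int),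
       O V g -> {ffun 'I_q -> nat} -> 'rV[R]_d -> R) : Prop :=
  [/\ [/\ open U, {in U &, injective phi}, {within U, continuous phi},
          forall V, open V -> V `<=` U -> open (phi @` V) &
          forall a, w a != 0],
      forall V, open V -> V `<=` U ->
        [/\ forall g, (forall x : O V g, model_section w (phi @` V) g (Phi V g x)),
            forall g (x y : O V g),
              (forall I v, (phi @` V) v -> Phi V g x I v = Phi V g y I v) -> x = y,
            forall g c, model_section w (phi @` V) g c ->
              exists x : O V g, forall I v, (phi @` V) v -> Phi V g x I v = c I v,
            forall g a (x y : O V g) I v, (phi @` V) v ->
              Phi V g (a *: x + y) I v = a * Phi V g x I v + Phi V g y I v &
            forall g h k (e : g + h = k) (x : O V g) (y : O V h) K v,
              admissible w K -> (phi @` V) v ->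
              Phi V k (gmul e x y) K v
              = \sum_(I : {ffun 'I_q -> 'I_(\sum_a K a).+1}
                        | [forall a, (I a <= K a)%N])
                  msign w [ffun a => nat_of_ord (I a)] [ffun a => (K a - I a)%N]
                  * Phi V g x [ffun a => nat_of_ord (I a)] v
                  * Phi V h y [ffun a => (K a - I a)%N] v],
      forall V I v, open V -> V `<=` U -> (phi @` V) v ->
        Phi V 0 (gone (O V)) I v = (I == [ffun=> 0%N])%:R &
      forall V V' g (x : O V g) I v, open V -> open V' -> V' `<=` V -> V `<=` U ->
        (phi @` V') v -> Phi V' g (res V' x) I v = Phi V g x I v].
End GradedChart.

(* A Z-graded manifold: a Hausdorff second countable space with a sheaf of
   graded algebras (a sheaf in each degree) having graded charts. *)
Record graded_manifold (R : realType) := GradedManifold {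
  gbody : topologicalType;
  gsheaf : set gbody -> galg R;
  gres : forall (U V : set gbody) (g : int), gsheaf U g -> gsheaf V g;
  gbody_hausdorff : hausdorff_space gbody;
  gbody_countable : @second_countable gbody;
  gres_lin : forall U V g a (x y : gsheaf U g), open U -> open V -> V `<=` U ->
    gres V (a *: x + y) = a *: gres V x + gres V y;
  gres_mul : forall U V g h k (e : g + h = k) (x : gsheaf U g) (y : gsheaf U h),
    open U -> open V -> V `<=` U ->
    gres V (gmul e x y) = gmul e (gres V x) (gres V y);
  gres_one : forall U V, open U -> open V -> V `<=` U ->
    gres V (gone (gsheaf U)) = gone (gsheaf V);
  gres_id : forall U g (x : gsheaf U g), open U -> gres U x = x;
  gres_comp : forall U V W g (x : gsheaf U g), open U -> open V -> open W ->
    V `<=` U -> W `<=` V -> gres W (gres V x) = gres W x;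
  gsheaf_local : forall (C : set (set gbody)) g
      (x y : gsheaf (\bigcup_(V in C) V) g),
    (forall V, C V -> open V) -> (forall V, C V -> gres V x = gres V y) -> x = y;
  gsheaf_glue : forall (C : set (set gbody)) g (s : forall V, gsheaf V g),
    (forall V, C V -> open V) ->
    (forall V W, C V -> C W -> gres (V `&` W) (s V) = gres (V `&` W) (s W)) ->
    exists x : gsheaf (\bigcup_(V in C) V) g, forall V, C V -> gres V x = s V;
  gcharts : forall y : gbody, exists U d q (w : 'I_q -> int) phi Phi,
    U y /\ graded_chart gres U (d := d) w phi Phi }.

Definition gfun {R : realType} (Y : graded_manifold R) : galg R :=
  gsheaf (setT : set (gbody Y)).

Lemma deg_target (n : nat) : 1 + (n%:Z - 1) = n%:Z.
Proof. by rewrite addrC subrK. Qed.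

Record hamiltonian_target {R : realType} (Y : graded_manifold R) (n : nat) :=
  HamiltonianTarget {
  t_omega : gform (gfun Y) 2 (n%:Z - 1);
  t_alpha : gform (gfun Y) 1 (n%:Z - 1);
  t_Q : gder (gfun Y) 1;
  t_Theta : gfun Y n%:Z;
  t_symplectic : symplectic t_omega;
  t_alpha_form : is_form t_alpha;
  t_exact : t_omega = fd t_alpha;
  t_cohomological : forall (g h k : int) (e : 1 + g = h) (e' : 1 + h = k) (f : gfun Y g),
    dact t_Q e' (dact t_Q e f) = 0;
  t_hamiltonian : fiota (deg_target n) t_Q t_omega
    = fd (t_Theta : gform (gfun Y) 0 n%:Z);
  t_master : poisson_bracket t_omega (deg_target n) (erefl (1 + n%:Z))
    t_Theta t_Theta 0 }.
Arguments t_omega {R Y n} _.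
Arguments t_alpha {R Y n} _.

Section Grading.
Context {R : realType} {V : lmodType R}.

Definition submodule (S : set V) : Prop :=
  S 0 /\ forall a x y, S x -> S y -> S (a *: x + y).

Definition is_grading {D : choiceType} (S : D -> set V) : Prop :=
  [/\ forall i, submodule (S i),
      forall x, exists s : seq D, exists2 f : D -> V,
        (forall i, i \in s -> S i (f i)) & x = \sum_(i <- s) f i &
      forall (s : seq D) (f : D -> V), uniq s ->
        (forall i, i \in s -> S i (f i)) -> \sum_(i <- s) f i = 0 ->
        forall i, i \in s -> f i = 0].
End Grading.

Record vector_fields (R : realType) := VectorFields {
  vfcar :> int -> lmodType R;
  vbr : forall g h, vfcar g -> vfcar h -> vfcar (g + h) }.

(* Forms with de Rham differential and contraction, subject to the graded
   Cartan relations; [cbideg q g] are the q-forms of internal degree g. *)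
Record cartan (R : realType) (V : vector_fields R) := Cartan {
  ccar :> lmodType R;
  cbideg : int -> int -> set ccar;
  cdel : {linear ccar -> ccar};
  ciota : forall g, V g -> {linear ccar -> ccar};
  cbideg_grading : is_grading (fun i : int * int => cbideg i.1 i.2);
  cbideg_neg : forall q g x, q < 0 -> cbideg q g x -> x = 0;
  cdel_deg : forall q g x, cbideg q g x -> cbideg (q + 1) g (cdel x);
  cdel2 : forall x, cdel (cdel x) = 0;
  ciota_lin : forall g a (X Y : V g) x,
    ciota (a *: X + Y) x = a *: ciota X x + ciota Y x;
  ciota_deg : forall g (X : V g) q h x,
    cbideg q h x -> cbideg (q - 1) (h + g) (ciota X x);
  ciotaC : forall g h (X : V g) (Y : V h) x,
    ciota X (ciota Y x) = ksgn ((g - 1) * (h - 1)) *: ciota Y (ciota X x);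
  (* iota_[X,Y] = [L_X, iota_Y] with L_X = [iota_X, delta] *)
  ciota_br : forall g h (X : V g) (Y : V h) x,
    let L z := ciota X (cdel z) + ksgn g *: cdel (ciota X z) in
    ciota (vbr X Y) x = L (ciota Y x) - ksgn (g * (h - 1)) *: ciota Y (L x) }.

Arguments cbideg {R V c} q g _.
Arguments cdel {R V c}.
Arguments ciota {R V c g} X.

Section CartanDefs.
Context {R : realType} {V : vector_fields R} {C : cartan V}.

Definition cform (q : int) (x : C) : Prop :=
  exists s : seq int, exists2 f : int -> C,
    (forall g, cbideg q g (f g)) & x = \sum_(g <- s) f g.

(* The graded commutator [iota_X, delta]; iota_X delta - delta iota_X if |X| = 1. *)
Definition clie g (X : V g) (x : C) : C :=
  ciota X (cdel x) + ksgn g *: cdel (ciota X x).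
End CartanDefs.

Definition is_pullback {R : realType} {V V' : vector_fields R} {C : cartan V}
    {C' : cartan V'} (f : C -> C') : Prop :=
  (forall q g x, cbideg q g x -> cbideg q g (f x)) /\
  (forall x, f (cdel x) = cdel (f x)).

(* Forms along field space on a product with a source T[1]G, with the source
   de Rham differential. *)
Record source_cartan (R : realType) (V : vector_fields R) := SourceCartan {
  sccar :> cartan V;
  dsrc : {linear sccar -> sccar};
  dsrc_deg : forall q g x,
    cbideg (c := sccar) q g x -> cbideg (c := sccar) q (g + 1) (dsrc x);
  dsrc2 : forall x, dsrc (dsrc x) = 0;
  dsrc_del : forall x, dsrc (cdel x) = - cdel (dsrc x);
  dsrc_iota : forall g (X : V g) x,
    ciota X (dsrc x) = ksgn (g - 1) *: dsrc (ciota X x) }.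

Arguments dsrc {R V s}.

(* The formal mapping-space hypothesis: field spaces F_F = Map(T[1]F, Y), their
   products F_F x T[1]G with the sources, and the operations on them. *)
Record mapping_spaces (R : realType) (n : nat) (M : manifold_with_faces R n)
    (o : forall F : face M, orientation F) (Y : graded_manifold R) :=
  MappingSpaces {
  vect : face M -> vector_fields R;
  fields : forall F, cartan (vect F);
  (* forms on F_F x T[1]G along F_F *)
  fsource : forall F G : face M, source_cartan (vect F);
  vect_faithful : forall F g (X : vect F g),
    (forall x : fields F, ciota X x = 0) -> X = 0;
  (* evaluation F_F x T[1]F -> Y *)
  ev : forall F p h, gform (gfun Y) p h -> fsource F F;
  ev_lin : forall F p h a b (x y : gform (gfun Y) p h), is_form x -> is_form y ->
    ev F (fcomb a b x y) = a *: ev F x + b *: ev F y;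
  ev_deg : forall F p h (x : gform (gfun Y) p h), is_form x ->
    cbideg p%:Z h (ev F x);
  ev_d : forall F p h (x : gform (gfun Y) p h), is_form x ->
    ev F (fd x) = cdel (ev F x);
  (* fiber integration F_F x T[1]G -> F_F *)
  fint : forall F G, {linear fsource F G -> fields F};
  fint_deg : forall F G q h (x : fsource F G), cbideg q h x ->
    cbideg q (h - (fdim G)%:Z) (fint F G x);
  fint_del : forall F G (x : fsource F G),
    cdel (fint F G x) = (-1) ^+ fdim G *: fint F G (cdel x);
  fint_iota : forall F G g (X : vect F g) (x : fsource F G),
    ciota X (fint F G x)
      = ksgn ((g - 1) * (fdim G)%:Z) *: fint F G (ciota X x);
  (* restriction of fields rho_FG : F_F -> F_G, for G included in F *)
  rho : forall F G, {linear fields G -> fields F};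
  rho_pullback : forall F G, fcar G `<=` fcar F -> is_pullback (rho F G);
  rho_id : forall F x, rho F F x = x;
  rho_comp : forall F G H x, fcar H `<=` fcar G -> fcar G `<=` fcar F ->
    rho F G (rho G H x) = rho F H x;
  (* rho_FG x id : F_F x T[1]H -> F_G x T[1]H *)
  rhox : forall F G H, {linear fsource G H -> fsource F H};
  rhox_pullback : forall F G H, fcar G `<=` fcar F -> is_pullback (rhox F G H);
  rhox_src : forall F G H x, fcar G `<=` fcar F ->
    rhox F G H (dsrc x) = dsrc (rhox F G H x);
  rhox_id : forall F H x, rhox F F H x = x;
  rhox_fint : forall F G H x, fcar G `<=` fcar F ->
    fint F H (rhox F G H x) = rho F G (fint G H x);
  (* id x inclusion : F_F x T[1]H -> F_F x T[1]G, for H included in G *)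
  incl : forall F G H, {linear fsource F G -> fsource F H};
  incl_pullback : forall F G H, fcar H `<=` fcar G -> is_pullback (incl F G H);
  incl_src : forall F G H x, fcar H `<=` fcar G ->
    incl F G H (dsrc x) = dsrc (incl F G H x);
  incl_iota : forall F G H g (X : vect F g) x, fcar H `<=` fcar G ->
    incl F G H (ciota X x) = ciota X (incl F G H x);
  (* rho_FG restricts maps: ev_F o (id x inclusion) = ev_G o (rho_FG x id) *)
  ev_restr : forall F G p h (x : gform (gfun Y) p h), fcar G `<=` fcar F ->
    is_form x -> incl F F G (ev F x) = rhox F G G (ev G x);
  stokes : forall F (x : fsource F F),
    fint F F (dsrc x)
      = \sum_(G \in fboundary F) incidence o F G *: fint F G (incl F F G x);
  (* lift of the source de Rham vector field by precomposition *)
  src_lift : forall F, vect F 1;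
  src_liftP : forall F p h (x : gform (gfun Y) p h), is_form x ->
    clie (src_lift F) (ev F x) = dsrc (ev F x);
  (* lifts of target vector fields by postcomposition *)
  tgt_lift : forall F g, gder (gfun Y) g -> vect F g;
  tgt_liftP : forall F g (X : gder (gfun Y) g) p h k (e : g + h = k)
      (x : gform (gfun Y) p.+1 h), is_form x ->
    ciota (tgt_lift F X) (ev F x) = ev F (fiota e X x);
  (* A tangent vector to a space of maps along rho_FG is determined by the
     derivatives of the evaluated functions of the target. *)
  ev_detects : forall F G g (X : vect F g) (X' : vect G g), fcar G `<=` fcar F ->
    (forall h (f : gfun Y h),
       clie X (rhox F G G (ev G (f : gform (gfun Y) 0 h)))
         = rhox F G G (clie X' (ev G (f : gform (gfun Y) 0 h)))) ->
    forall x : fields G, ciota X (rho F G x) = rho F G (ciota X' x) }.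

Section Transgression.
Context {R : realType} {n : nat} {M : manifold_with_faces R n}
  {o : forall F : face M, orientation F} {Y : graded_manifold R}
  (S : mapping_spaces o Y).
Implicit Types (F G H : face M).

Definition transgr (k : nat) F p h (chi : gform (gfun Y) p h) : fields S F :=
  iter k (ciota (src_lift S F)) (fint S F F (ev S F chi)).

(* T rho_FG (X) = X' o rho_FG *)
Definition rho_related F G g (X : vect S F g) (X' : vect S G g) : Prop :=
  forall x : fields S G, ciota X (rho S F G x) = rho S F G (ciota X' x).

Definition families : Type := forall F, nat -> fields S F.

Definition cochain (p : int) (eta : families) : Prop :=
  forall F k, cform (p - k%:Z) (eta F k).

Definition famD (eta : families) : families := fun F k =>
  (-1) ^+ fdim F *: cdel (eta F k)
  + (if k is k'.+1 then
       \sum_(G \in fboundary F) incidence o F G *: rho S F G (eta G k')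
     else 0).

Definition transgression p h (chi : gform (gfun Y) p h) : families :=
  fun F k => (k`!%:R)^-1 *: transgr k F chi.

Definition weakly_nondegenerate F (omega : fields S F) : Prop :=
  forall g (X : vect S F g), ciota X omega = 0 -> X = 0.

(* h = {f, f'} = X_f f' with iota_{X_f} omega = delta f and |X_f| = g. *)
Definition field_bracket F (omega : fields S F) (g : int)
    (f f' h : fields S F) : Prop :=
  exists2 X : vect S F g, ciota X omega = cdel f & h = clie X f'.

Definition strict_BFV (r : nat) F (omega : fields S F) (Q : vect S F 1)
    (action : fields S F) : Prop :=
  [/\ cbideg 2 (r%:Z - 1) omega /\ cdel omega = 0,
      weakly_nondegenerate omega,
      cbideg 0 r%:Z action,
      forall x : fields S F, clie Q (clie Q x) = 0 &
      ciota Q omega = (-1) ^+ fdim F *: cdel action /\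
      field_bracket omega 1 action action 0].

Variable t : hamiltonian_target Y n.

Definition omegaF F : fields S F := transgr 0 F (t_omega t).
Definition alphaF F : fields S F := transgr 0 F (t_alpha t).
Definition actionF F : fields S F :=
  transgr 1 F (t_alpha t) + transgr 0 F (t_Theta t : gform (gfun Y) 0 n%:Z).
Definition QF F : vect S F 1 := src_lift S F + tgt_lift S F (t_Q t).
End Transgression.

(* Main.v *)
From HB Require Import structures.
Require Import Defs.
From mathcomp Require Import all_boot all_order all_algebra.
From mathcomp Require Import perm ring lra zify.
From mathcomp Require Import all_classical all_reals all_analysis.

Set Implicit Arguments.
Unset Strict Implicit.
Unset Printing Implicit Defensive.

Import Order.TTheory GRing.Theory Num.Theory.
Import numFieldNormedType.Exports.

Local Open Scope classical_set_scope.
Local Open Scope ring_scope.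

(* Transgression is governed by three identities on the fields times the source:
   evaluation commutes with the differentials, the Lie derivative along the lifted
   source field is the source differential on evaluated forms, and Stokes turns the
   fiber integral of a source-exact form into the boundary terms. Moving delta past k
   contractions with the lifted source field, which commutes with its own Lie derivative,
   gives (iv), and (ii) is the case k = 1 plus the Hamiltonian condition of the target.
   The vanishing of the graded brackets [D, D] and [Q, Q] of the lifted fields is read
   off the evaluated functions of the target, which detect tangent vectors. For (vi),
   {S, S} is up to sign the double contraction of omega with Q; on a closed face its
   three parts are transgressions of exact forms of too small form degree, or vanish by
   Q Theta = 0, which is the master equation of the target.

   That the face differential squares to zero, hence (v) and the cochain property, is a
   statement on manifolds with corners: between F and a face H of codimension two in F
   lie exactly two faces, and they contribute opposite signs. Transitions of charts
   have invertible differentials preserving the inward cone, so the depth of a point is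
   independent of the chart. Embeddedness of the hypersurfaces makes every face a
   single coordinate sheet near each of its points, and the sign comparing two
   orientations through an outward vector is locally constant on the connected open
   stratum of a face, so that all signs can be evaluated at one corner point of H. *)

(** * Continuously differentiable maps *)

Section RowVectors.
Context {R : realType}.

Lemma ler_coord_norm {m n} (A : 'M[R]_(m, n)) i j : `|A i j| <= `|A|.
Proof.
by rewrite [leRHS]/Num.Def.normr /= mx_normrE; apply/bigmax_geP; right; exists (i, j).
Qed.

Lemma mx_norm_ler {m n} (A : 'M[R]_(m, n)) (e : R) :
  0 <= e -> (forall i j, `|A i j| <= e) -> `|A| <= e.
Proof.
by move=> e0 Ae; rewrite [leLHS]/Num.Def.normr /= mx_normrE bigmax_le.
Qed.

End RowVectors.

Section Segments.
Context {R : realType} {V : normedModType R}.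

Lemma segment_ball (p x y : V) (d l : R) : 0 <= l <= 1 ->
  `|x - p| < d -> `|y - p| < d -> `|x + l *: (y - x) - p| < d.
Proof.
move=> /andP[l0 l1] xd yd.
have -> : x + l *: (y - x) - p = (1 - l) *: (x - p) + l *: (y - p).
  rewrite [LHS]addrAC [(1 - l) *: _]scalerBl scale1r [RHS]addrAC -[RHS]addrA.
  by rewrite -scalerBr opprB [y - p + _]addrA subrK.
have [->|ln0] := eqVneq l 0; first by rewrite subr0 scale1r scale0r addr0.
apply: le_lt_trans (ler_normD _ _) _.
rewrite (normrZ (1 - l)) (normrZ l) (ger0_norm l0) ger0_norm ?subr_ge0 //.
have -> : d = (1 - l) * d + l * d by rewrite -mulrDl subrK mul1r.
rewrite ler_ltD //; first by rewrite ler_wpM2l ?subr_ge0 // ltW.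
by rewrite ltr_pM2l // lt_def ln0.
Qed.
End Segments.

Section LineDerivative.
Context {R : realType} {U V : normedModType R}.

Lemma line_is_derive (f : U -> V) (q v : U) (s : R) :
  derivable f (q + s *: v) v ->
  is_derive s (1 : R) (fun t : R => f (q + t *: v)) ('D_v f (q + s *: v)).
Proof.
move=> df.
have eqf : (fun t : R => t^-1 *:
    (((fun t : R => f (q + t *: v)) \o shift s) (t *: (1 : R)) - f (q + s *: v)))
  = (fun t : R => t^-1 *: ((f \o shift (q + s *: v)) (t *: v) - f (q + s *: v))).
  apply/funext => t /=; congr (_ *: (f _ - _)).
  have -> : t *: (1 : R) = t by exact: mulr1.
  by rewrite scalerDl addrCA.
by split; rewrite /derivable /derive eqf.
Qed.
End LineDerivative.

Section ContinuouslyDifferentiable.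
Context {R : realType} {m : nat}.
Implicit Types (p u v : 'rV[R]_m).

(** Mean value theorem along a segment in direction [v]. The bound is uniform in the base point [q],
    as needed at the intermediate points of a staircase path. *)
Lemma increment_bound (f : 'rV[R]_m -> R) p v (r eps : R) : 0 < r -> 0 < eps ->
  (forall x, `|x - p| < r -> derivable f x v /\ `|'D_v f p - 'D_v f x| <= eps) ->
  \forall d \near 0^'+, forall q (a : R), `|q - p| < d -> `|q + a *: v - p| < d ->
    `|f (q + a *: v) - f q - a * 'D_v f p| <= eps * `|a|.
Proof.
move=> r0 eps0 df; near=> d.
have dr : d <= r by near: d; apply: nbhs_right_le.
have He' x : `|x - p| < d -> derivable f x v /\ `|'D_v f p - 'D_v f x| <= eps.
  by move=> xp; apply: df (lt_le_trans xp dr).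
have incr (b : R) (x : 'rV[R]_m) : 0 <= b -> `|x - p| < d -> `|x + b *: v - p| < d ->
    `|f (x + b *: v) - f x - b * 'D_v f p| <= eps * `|b|.
  move: b x => a q a0 qd qad.
  have seg s : s \in `[0, a] -> `|q + s *: v - p| < d.
    rewrite in_itv /= => /andP[s0 sa].
    have [a00|an0] := eqVneq a 0.
      have -> : s = 0 by apply/le_anti; rewrite s0 -{1}a00 sa.
      by rewrite scale0r addr0.
    have apos : 0 < a by rewrite lt_def an0.
    have -> : s *: v = (s / a) *: (q + a *: v - q).
      by rewrite addrC addKr scalerA divfK.
    by apply: segment_ball => //; rewrite divr_ge0 // ler_pdivrMr // mul1r.
  have dg s : s \in `[0, a] ->
      is_derive s (1 : R) (fun t : R => f (q + t *: v)) ('D_v f (q + s *: v)).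
    by move=> /seg /He' [? _]; apply: line_is_derive.
  have cg : {within `[0, a], continuous (fun t : R => f (q + t *: v))}.
    by apply: derivable_within_continuous => s /dg [].
  have dg' s : s \in `]0, a[ ->
      is_derive s (1 : R) (fun t : R => f (q + t *: v)) ('D_v f (q + s *: v)).
    by rewrite in_itv /= => /andP[s0 sa]; apply: dg; rewrite in_itv /= !ltW.
  have [c ca] := MVT_segment a0 dg' cg.
  have [_ Dc] := He' _ (seg _ ca).
  rewrite scale0r addr0 subr0 => ->.
  by rewrite [a * _]mulrC -mulrBl normrM ler_wpM2r // distrC.
move=> q a qd qad; have [a0|a0] := leP 0 a; first exact: incr.
have := incr (- a) (q + a *: v); rewrite scaleNr addrK normrN => /(_ _ qad qd).
rewrite oppr_ge0 (ltW a0) => /(_ isT); congr (_ <= _); rewrite -normrN; congr `|_|.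
ring.
Unshelve. all: by end_near. Qed.

(** In the maximum norm, cutting off coordinates does not increase the norm, so the staircase path
    from [p] to [p + u] stays in every ball about [p] that contains its end point. *)
Lemma partial_sum_norm (u : 'rV[R]_m) (k : nat) :
  `|\sum_(j < m | (j < k)%N) u 0 j *: delta_mx 0 j : 'rV[R]_m| <= `|u|.
Proof.
apply: mx_norm_ler => // i j; rewrite ord1 summxE.
have -> : \sum_(l < m | (l < k)%N) (u 0 l *: delta_mx 0 l : 'rV[R]_m) 0 j
    = if (j < k)%N then u 0 j else 0.
  case: ifP => jk.
    rewrite (bigD1 j) //= !mxE !eqxx mulr1 big1 ?addr0 // => l /andP[_ lj].
    by rewrite !mxE eq_sym (negbTE lj) andbF mulr0.
  rewrite big1 // => l lk; rewrite !mxE eqxx /=.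
  by case: eqP => [jl|]; rewrite ?mulr0 //; move: lk; rewrite -jl jk.
by case: ifP => _; [apply: ler_coord_norm|rewrite normr0].
Qed.

(** The increment telescopes along a path from [p] to [p + u] that changes one coordinate at a time;
    [increment_bound] controls each step. *)
Lemma c1_expansion (f : 'rV[R]_m -> R) p (eps : R) : 0 < eps ->
  (forall v (e : R), 0 < e -> exists2 r : R, 0 < r & forall x, `|x - p| < r ->
     derivable f x v /\ `|'D_v f p - 'D_v f x| <= e) ->
  \forall u \near (0 : 'rV[R]_m),
    `|f (p + u) - f p - \sum_(j < m) u 0 j * 'D_(delta_mx 0 j) f p| <= eps * `|u|.
Proof.
move=> eps0 df.
(* The tolerance is shared among the [m] steps; [m.+1] keeps it positive when [m = 0]. *)
pose eps' := eps / m.+1%:R.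
have eps'0 : 0 < eps' by rewrite divr_gt0.
have [d [d0 Hd]] : exists d : R, 0 < d /\ forall j : 'I_m, forall q (a : R),
    `|q - p| < d -> `|q + a *: delta_mx 0 j - p| < d ->
    `|f (q + a *: delta_mx 0 j) - f q - a * 'D_(delta_mx 0 j) f p| <= eps' * `|a|.
  have [d] : exists d : R, 0 < d /\ forall j : 'I_m, forall q (a : R),
    `|q - p| < d -> `|q + a *: delta_mx 0 j - p| < d ->
    `|f (q + a *: delta_mx 0 j) - f q - a * 'D_(delta_mx 0 j) f p| <= eps' * `|a|.
    apply: (@filter_ex _ (0^'+ : set_system R)); near=> d; split => //.
    move=> j; move: j; near: d; apply: filter_forall => j.
    by have [r r0 fr] := df (delta_mx 0 j) _ eps'0; apply: increment_bound fr.
  by exists d.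
near=> u.
have ud : `|u| < d.
  by near: u; apply/nbhs_ballP; exists d => //= y; rewrite -ball_normE /= sub0r normrN.
pose q k : 'rV[R]_m := p + \sum_(j < m | (j < k)%N) u 0 j *: delta_mx 0 j.
have qp k : `|q k - p| < d.
  by rewrite /q addrC addKr (le_lt_trans (partial_sum_norm _ _)).
have qS (j : 'I_m) : q j.+1 = q j + u 0 j *: delta_mx 0 j.
  rewrite /q -[RHS]addrA; congr (_ + _).
  rewrite (bigD1 j) //= addrC; congr (_ + _).
  by apply: eq_bigl => l; rewrite ltnS ltn_neqAle andbC.
have q0 : q 0%N = p by rewrite /q big_pred0 ?addr0.
have qm : q m = p + u.
  rewrite /q; congr (_ + _); rewrite [RHS]row_sum_delta.
  by apply: eq_bigl => j; rewrite ltn_ord.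
have tel : \sum_(j < m) (f (q j.+1) - f (q j)) = f (q m) - f (q 0%N).
  by rewrite -(big_mkord xpredT (fun j => f (q j.+1) - f (q j))) telescope_sumr.
rewrite qm q0 in tel; rewrite -tel.
rewrite -sumrB (le_trans (ler_norm_sum _ _ _)) //.
apply: (@le_trans _ _ (\sum_(j < m) eps' * `|u|)).
  apply: ler_sum => j _; rewrite qS.
  apply: le_trans (Hd j _ _ (qp j) _) _; first by rewrite -qS.
  by rewrite ler_wpM2l ?ler_coord_norm // ltW.
rewrite sumr_const card_ord -[leLHS]mulr_natl mulrA ler_wpM2r //.
by rewrite /eps' mulrCA ger_pMr // ler_pdivrMr // mul1r ler_nat.
Unshelve. all: by end_near. Qed.
End ContinuouslyDifferentiable.

Section SmoothMaps.
Context {R : realType} {m k : nat}.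
Implicit Types (p x v : 'rV[R]_m).

Lemma mulmxr_continuous (A : 'M[R]_(m, k)) :
  continuous (mulmxr A : 'rV[R]_m -> 'rV[R]_k).
Proof.
apply: continuousfor0_continuous; rewrite /prop_for /continuous_at linear0.
apply/(@cvgrPdist_le _ _ _ (nbhs (0 : 'rV[R]_m))) => e e0; near=> u.
rewrite sub0r normrN; apply: mx_norm_ler => [|i j]; first exact: ltW.
rewrite ord1 mxE (le_trans (ler_norm_sum _ _ _)) //.
apply: (@le_trans _ _ (\sum_(l < m) `|u| * `|A|)).
  by apply: ler_sum => l _; rewrite normrM ler_pM ?normr_ge0 ?ler_coord_norm.
rewrite sumr_const card_ord -[leLHS]mulr_natr -mulrA.
have u_small : `|u| <= e / (m.+1%:R * (`|A| + 1)).
  near: u; apply/nbhs_ballP; exists (e / (m.+1%:R * (`|A| + 1))) => /=.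
    by rewrite divr_gt0 // mulr_gt0 // ltr_wpDl.
  by move=> y; rewrite -ball_normE /= sub0r normrN => /ltW.
rewrite ler_pdivlMr in u_small; last by rewrite mulr_gt0 // ltr_wpDl.
apply: le_trans u_small; rewrite ler_wpM2l // mulrC ler_pM // ?ler_nat //.
by rewrite lerDl.
Unshelve. all: by end_near. Qed.

(** [smooth_on] speaks of directional derivatives only, while the chain rule asks for a Frechet
    differential. The matrix of partial derivatives provides it, by [c1_expansion] in each
    component. *)
Lemma smooth_differentiable (W : set 'rV[R]_m) (g : 'rV[R]_m -> 'rV[R]_k)
  (p : 'rV[R]_m) :
  open W -> smooth_on W g -> W p -> differentiable g p.
Proof.
move=> oW sg Wp; have /nbhs_ballP[e /= e0 He] : nbhs p W by exact: open_nbhs_nbhs.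
have dg v x : W x -> derivable g x v by move=> Wx; have [+ _] := sg [::] x Wx; apply.
have cg v : {for p, continuous ('D_v g)} by have [] := sg [:: v] p Wp.
pose f (i : 'I_k) x : R := g x 0 i.
have Df i v x : W x -> 'D_v (f i) x = 'D_v g x 0 i.
  by move=> Wx; rewrite (derive_mx (dg v x Wx)) mxE.
have fD i v (eps : R) : 0 < eps -> exists2 r : R, 0 < r & forall x, `|x - p| < r ->
    derivable (f i) x v /\ `|'D_v (f i) p - 'D_v (f i) x| <= eps.
  move=> eps0.
  have /nbhs_ballP[r /= r0 Hr] : \forall x \near p, `|'D_v g p - 'D_v g x| <= eps.
    by move/cvgrPdist_le : (cg v); apply.
  exists (Num.min e r) => [|x]; first by rewrite lt_min e0.
  rewrite lt_min => /andP[xe xr].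
  have Wx : W x by apply: He; rewrite -ball_normE /= distrC.
  split; first by have /derivable_mxP := dg v x Wx; apply.
  rewrite !Df //; apply: le_trans (Hr x _); last by rewrite -ball_normE /= distrC.
  by apply: le_trans (ler_coord_norm _ 0 i); rewrite !mxE.
pose A := \matrix_(j < m, i < k) 'D_(delta_mx 0 j) (f i) p.
pose L : {linear 'rV[R]_m -> 'rV[R]_k} := mulmxr A.
have cL : continuous L by exact: mulmxr_continuous.
have expansion : g \o shift p = cst (g p) + L +o_ (0 : 'rV[R]_m) id.
  apply/eqaddoP => eps eps0; near=> u.
  apply: mx_norm_ler => [|z i]; first by rewrite mulr_ge0 // ltW.
  rewrite ord1 !mxE /= opprD addrA.
  have -> : \sum_j u 0 j * A j i = \sum_j u 0 j * 'D_(delta_mx 0 j) (f i) p.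
    by apply: eq_bigr => j _; rewrite mxE.
  rewrite [u + p]addrC -[g _ 0 i]/(f i (p + u)) -[g p 0 i]/(f i p).
  move: i; near: u; apply: filter_forall => i.
  exact: c1_expansion eps0 (fD i).
apply/diff_locallyP.
by rewrite (diff_unique cL expansion); split.
Unshelve. all: by end_near. Qed.
End SmoothMaps.

(** * Coordinate subspaces and their dimensions *)

Section CoordinateSubspaces.
Context {K : fieldType} {n : nat}.
Implicit Types (J : {set 'I_n}) (v : 'rV[K]_n).

Lemma span_delta_coord0 (s : seq 'I_n) (j : 'I_n) v :
  j \notin s -> v \in <<[seq (delta_mx 0%R i : 'rV[K]_n) | i <- s]>>%VS -> v 0 j = 0.
Proof.
elim: s v => [|i s IH] v /=; first by rewrite span_nil memv0 => _ /eqP ->; rewrite mxE.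
rewrite inE negb_or => /andP[ji js]; rewrite span_cons => /memv_addP[x /vlineP[a ->]].
by move=> [y /(IH _ js) y0 ->]; rewrite !mxE y0 eqxx (negbTE ji) mulr0 addr0.
Qed.

Lemma delta_free (s : seq 'I_n) :
  uniq s -> free [seq (delta_mx 0%R i : 'rV[K]_n) | i <- s].
Proof.
elim: s => [|i s IH] /=; first by rewrite nil_free.
move=> /andP[i_s us]; rewrite free_cons IH // andbT.
by apply/negP => /(span_delta_coord0 i_s)/eqP; rewrite mxE !eqxx oner_eq0.
Qed.

(** The vectors vanishing on [J] ([memv_coord_space]), presented as a span of basis vectors so that
    the dimension count is immediate. *)
Definition coord_space J : {vspace 'rV[K]_n} :=
  <<[seq (delta_mx 0%R i : 'rV[K]_n) | i <- enum (~: J)%SET]>>%VS.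

Lemma dim_coord_space J : \dim (coord_space J) = (n - #|J|)%N.
Proof.
have /eqP -> := delta_free (enum_uniq (~: J)%SET).
by rewrite size_map -cardE -[X in (X - _)%N]card_ord -(cardsC J) addKn.
Qed.

Lemma memv_coord_space J v :
  reflect (forall j, j \in J -> v 0 j = 0) (v \in coord_space J).
Proof.
apply: (iffP idP) => [vJ j jJ|v0].
  by apply: span_delta_coord0 vJ; rewrite mem_enum inE jJ.
rewrite [v]row_sum_delta; apply: memv_suml => i _.
have [iJ|iJ] := boolP (i \in J); first by rewrite v0 // scale0r mem0v.
by apply/memvZ/memv_span/map_f; rewrite mem_enum inE.
Qed.
End CoordinateSubspaces.

Section OneSidedDerivative.
Context {R : realType} {m n : nat}.
Implicit Types (f : 'rV[R]_m -> 'rV[R]_n) (p v : 'rV[R]_m).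

(** Near a boundary point only rays into the corner lie in the image of a chart, so derivatives of
    transition maps are read off from limits at 0 from the right. *)
Lemma derive_right f p v : derivable f p v ->
  t^-1 *: (f (p + t *: v) - f p) @[t --> (0 : R)^'+] --> 'D_v f p.
Proof.
move=> df; apply: cvg_dnbhs_at_right.
have -> : (fun t : R => t^-1 *: (f (p + t *: v) - f p))
    = (fun t : R => t^-1 *: ((f \o shift p) (t *: v) - f p)).
  by apply/funext => t /=; rewrite [t *: v + p]addrC.
exact: df.
Qed.

Lemma derive_right_coord f p v i : derivable f p v ->
  t^-1 * (f (p + t *: v) 0 i - f p 0 i) @[t --> (0 : R)^'+] --> ('D_v f p) 0 i.
Proof.
move=> /derive_right df.
have -> : (fun t : R => t^-1 * (f (p + t *: v) 0 i - f p 0 i))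
    = (fun N : 'rV[R]_n => N 0 i) \o (fun t : R => t^-1 *: (f (p + t *: v) - f p)).
  by apply/funext => t; rewrite /= !mxE.
by apply: cvg_comp df _; apply: coord_continuous.
Qed.

Lemma derive_coord_ge0 f p v i : derivable f p v ->
  (\forall t \near (0 : R)^'+, f p 0 i <= f (p + t *: v) 0 i) -> 0 <= ('D_v f p) 0 i.
Proof.
move=> df fp; apply: (cvgr_to_ge (derive_right_coord df)); near=> t.
have t0 : 0 < t by near: t; apply: nbhs_right_gt.
rewrite mulr_ge0 ?invr_ge0 ?(ltW t0) //.
by rewrite subr_ge0; near: t.
Unshelve. all: by end_near. Qed.

Lemma derive_coord_eq0 f p v i : derivable f p v ->
  (\forall t \near (0 : R)^'+, f (p + t *: v) 0 i = f p 0 i) -> ('D_v f p) 0 i = 0.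
Proof.
move=> df fp; apply/le_anti/andP; split.
  apply: (cvgr_to_le (derive_right_coord df)); near=> t.
  have -> // : f (p + t *: v) 0 i = f p 0 i by near: t.
  by rewrite subrr mulr0.
apply: (cvgr_to_ge (derive_right_coord df)); near=> t.
have -> // : f (p + t *: v) 0 i = f p 0 i by near: t.
by rewrite subrr mulr0.
Unshelve. all: by end_near. Qed.
End OneSidedDerivative.

Lemma derive_right_id {R : realType} {n} (f : 'rV[R]_n -> 'rV[R]_n) p v :
  derivable f p v -> f p = p ->
  (\forall t \near (0 : R)^'+, f (p + t *: v) = p + t *: v) -> 'D_v f p = v.
Proof.
move=> df fp fv; apply/rowP => i.
apply: (cvg_unique _ (derive_right_coord df)) => //.
apply: (@cvg_trans _ (cst (v 0 i) @ (0 : R)^'+)); last exact: cvg_cst.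
apply: near_eq_cvg; near=> t.
have t0 : 0 < t by near: t; apply: nbhs_right_gt.
by rewrite fp (near fv t) // !mxE [p 0 i + _]addrC addrK mulrA mulVf ?mul1r ?gt_eqF //.
Unshelve. all: by end_near. Qed.

(** * Charts of a manifold with faces *)

Section ChartNeighborhoods.
Context {R : realType} {n : nat} {M : manifold_with_faces R n}.
Implicit Types (c : chart R n M) (x y z : M) (U : set M) (J : {set 'I_n}).

Lemma chart_near c x (e : R) : atlas c -> cdom c x -> 0 < e ->
  \forall y \near x, cdom c y /\ `|cmap c y - cmap c x| < e.
Proof.
move=> ac cx e0; have [_ oc _ cc _] := atlas_chart ac.
have nc : nbhs x (cdom c) by exact: open_nbhs_nbhs.
move: cc; rewrite continuous_open_subspace // => /(_ x (mem_set cx)).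
move=> /cvgrPdist_lt /(_ _ e0) near_e.
by near=> y; split; [near: y|rewrite distrC; near: y].
Unshelve. all: by end_near. Qed.

Lemma chart_ball c x U : atlas c -> cdom c x -> nbhs x U ->
  exists2 e : R, 0 < e & forall w, corner (crank c) w -> `|w - cmap c x| < e ->
    exists z, [/\ cdom c z, U z & cmap c z = w].
Proof.
move=> ac cx nU; have [_ oc _ _ /(_ (U^° `&` cdom c))] := atlas_chart ac.
case=> [|z []//|W oW imW]; first by apply: openI => //; apply: open_interior.
have Wx : W (cmap c x).
  have : (W `&` corner (crank c)) (cmap c x) by rewrite -imW; exists x.
  by case.
have /nbhs_ballP[e /= e0 He] : nbhs (cmap c x) W by exact: open_nbhs_nbhs.
exists e => // w cw we.
have : (W `&` corner (crank c)) w.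
  by split=> //; apply: He; rewrite -ball_normE /= distrC.
by rewrite -imW => -[z [/interior_subset Uz cz] <-]; exists z.
Qed.

Lemma chart_corner c x : atlas c -> cdom c x -> corner (crank c) (cmap c x).
Proof.
move=> ac cx; have [_ oc _ _ /(_ (cdom c) oc)] := atlas_chart ac.
case=> // W _ imW.
have : (W `&` corner (crank c)) (cmap c x) by rewrite -imW; exists x.
by case.
Qed.

Lemma chart_inj c x y : atlas c -> cdom c x -> cdom c y ->
  cmap c x = cmap c y -> x = y.
Proof.
move=> ac cx cy; have [_ _ inj _ _] := atlas_chart ac.
by apply: inj; rewrite inE.
Qed.

Lemma zerosetP c x (i : 'I_n) :
  reflect ((i < crank c)%N /\ cmap c x 0 i = 0) (i \in zeroset c x).
Proof. by rewrite inE; apply: (iffP andP) => -[? /eqP]. Qed.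

Lemma zeroset_pos c x (i : 'I_n) : atlas c -> cdom c x -> (i < crank c)%N ->
  i \notin zeroset c x -> 0 < cmap c x 0 i.
Proof.
move=> ac cx ir; rewrite inE ir /= lt_def => ->.
exact: chart_corner ac cx i ir.
Qed.

Lemma zeroset_near c x : atlas c -> cdom c x ->
  \forall y \near x, cdom c y /\ zeroset c y \subset zeroset c x.
Proof.
move=> ac cx.
have pos : \forall y \near x, forall i : 'I_n, (i < crank c)%N ->
    i \notin zeroset c x -> 0 < cmap c y 0 i.
  apply: filter_forall => i.
  have [iZ|iZ] := boolP (i \in zeroset c x); first by near=> y.
  have [ir|_] := ltnP i (crank c); last by near=> y.
  have p0 := zeroset_pos ac cx ir iZ.
  near=> y => _ _.
  have [_ yx] : cdom c y /\ `|cmap c y - cmap c x| < cmap c x 0 i.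
    by near: y; apply: chart_near.
  have := le_lt_trans (ler_coord_norm (cmap c y - cmap c x) 0 i) yx.
  by rewrite !mxE ltr_distl subrr => /andP[].
near=> y; split.
  by have [] : cdom c y /\ `|cmap c y - cmap c x| < 1 by near: y; apply: chart_near.
apply/fintype.subsetP => i /zerosetP[ir yi]; apply/contraT => iZ.
have : 0 < cmap c y 0 i by move: i ir iZ {yi}; near: y.
by rewrite yi ltxx.
Unshelve. all: by end_near. Qed.

Lemma chart_ray c x (v : 'rV[R]_n) U : atlas c -> cdom c x ->
  (forall i, i \in zeroset c x -> 0 <= v 0 i) -> nbhs x U ->
  \forall t \near (0 : R)^'+,
    exists z, [/\ cdom c z, U z & cmap c z = cmap c x + t *: v].
Proof.
move=> ac cx v0 nU; have [e e0 He] := chart_ball ac cx nU.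
have in_corner : \forall t \near (0 : R)^'+, corner (crank c) (cmap c x + t *: v).
  apply: filter_forall => i.
  have [ir|_] := ltnP i (crank c); last by near=> t.
  have [iZ|iZ] := boolP (i \in zeroset c x).
    near=> t => _; have t0 : 0 < t by near: t; apply: nbhs_right_gt.
    have [_ xi] := zerosetP _ _ _ iZ.
    by rewrite !mxE xi add0r mulr_ge0 ?v0 // ltW.
  have p0 := zeroset_pos ac cx ir iZ; have v1 : 0 < `|v 0 i| + 1 by rewrite ltr_wpDl.
  near=> t => _; have t0 : 0 < t by near: t; apply: nbhs_right_gt.
  have : t <= cmap c x 0 i / (`|v 0 i| + 1).
    by near: t; apply: nbhs_right_le; apply: divr_gt0.
  rewrite ler_pdivlMr // !mxE => tv.
  have : - (t * v 0 i) <= cmap c x 0 i; last by rewrite -subr_ge0 opprK.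
  apply: le_trans tv; rewrite -mulrN ler_wpM2l ?(ltW t0) //.
  by rewrite (le_trans (ler_norm _)) // normrN lerDl.
near=> t; apply: He; first by near: t.
have t0 : 0 < t by near: t; apply: nbhs_right_gt.
rewrite addrC addKr normrZ gtr0_norm //.
have : t < e / (`|v| + 1).
  by near: t; apply: nbhs_right_lt; rewrite divr_gt0 // ltr_wpDl.
rewrite ltr_pdivlMr; last by rewrite ltr_wpDl.
by apply: le_lt_trans; rewrite ler_wpM2l ?(ltW t0) // lerDl.
Unshelve. all: by end_near. Qed.

(** Moving [x] along the vector with entry 1 at the vanishing coordinates outside [J] makes exactly
    these positive. The points so obtained serve below as test points for cut sets. *)
Lemma sheet_dense c x J U : atlas c -> cdom c x -> J \subset zeroset c x ->
  nbhs x U -> exists z, [/\ cdom c z, U z & zeroset c z = J].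
Proof.
move=> ac cx JZ nU.
pose v : 'rV[R]_n := \row_i (i \in zeroset c x :\: J)%SET%:R.
have [t [t0 [z [cz [Uz Zz] zt]]]] : exists t : R, 0 < t /\ exists z,
    [/\ cdom c z, U z /\ zeroset c z \subset zeroset c x & cmap c z = cmap c x + t *: v].
  apply: (@filter_ex _ ((0 : R)^'+)); near=> t; split.
    by near: t; apply: nbhs_right_gt.
  near: t; apply: chart_ray => // [i _|]; first by rewrite mxE ler0n.
  by near=> y; split; [near: y|have [] : cdom c y /\ zeroset c y \subset zeroset c x
    by near: y; apply: zeroset_near].
exists z; split=> //; apply/setP => i.
have zi : cmap c z 0 i = cmap c x 0 i + t * (i \in zeroset c x :\: J)%SET%:R.
  by rewrite zt !mxE.
apply/idP/idP => [iz|iJ].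
  have iZ := fintype.subsetP Zz i iz; have [_ xi] := zerosetP _ _ _ iZ.
  have [_] := zerosetP _ _ _ iz; rewrite zi xi add0r finset.in_setD iZ andbT.
  by case: (i \in J) => //= /eqP; rewrite mulr1 gt_eqF.
have iZ := fintype.subsetP JZ i iJ; have [ir xi] := zerosetP _ _ _ iZ.
apply/zerosetP; split=> //.
by rewrite zi xi finset.in_setD iJ /= mulr0 addr0.
Unshelve. all: by end_near. Qed.
End ChartNeighborhoods.

Section ChartSegments.
Context {R : realType} {n : nat} {M : manifold_with_faces R n}.
Implicit Types (c : chart R n M) (x y z : M) (U : set M) (J : {set 'I_n}).

Lemma corner_segment {r : nat} (a b : 'rV[R]_n) (l : R) : 0 <= l <= 1 ->
  corner r a -> corner r b -> corner r (a + l *: (b - a)).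
Proof.
move=> /andP[l0 l1] ca cb i ir; rewrite !mxE.
have -> : a 0 i + l * (b 0 i - a 0 i) = (1 - l) * a 0 i + l * b 0 i by ring.
by rewrite addr_ge0 // mulr_ge0 ?ca ?cb // subr_ge0.
Qed.

(** The set is the image of the unit interval under an inverse of the chart along the segment,
    obtained by choice; [chart_ball] makes this inverse continuous. *)
Lemma chart_segment_connected c (p : 'rV[R]_n) (e : R) y z : atlas c ->
  (forall w, corner (crank c) w -> `|w - p| < e ->
     exists2 x, cdom c x & cmap c x = w) ->
  cdom c y -> cdom c z -> `|cmap c y - p| < e -> `|cmap c z - p| < e ->
  connected [set x | cdom c x /\
    exists2 l : R, 0 <= l <= 1 & cmap c x = cmap c y + l *: (cmap c z - cmap c y)].
Proof.
move=> ac surj cy cz ye ze.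
pose w (l : R) := cmap c y + l *: (cmap c z - cmap c y).
have /choice[h hP] (l : R) : exists x, 0 <= l <= 1 -> cdom c x /\ cmap c x = w l.
  case: (boolP (0 <= l <= 1)) => [l01|_]; last by exists y.
  have [||x cx xw] := surj (w l).
  - by apply: corner_segment => //; apply: chart_corner.
  - exact: segment_ball.
  by exists x.
have -> : [set x | cdom c x /\ exists2 l : R, 0 <= l <= 1 & cmap c x = w l]
    = h @` `[0, 1].
  apply/seteqP; split => [x [cx [l l01 xw]]|x [l /= l01 <-]].
    exists l; first by rewrite /= in_itv.
    by have [cl hl] := hP l l01; apply: (chart_inj ac) => //; rewrite hl.
  rewrite in_itv /= in l01; have [cl hl] := hP l l01.
  by split=> //; exists l.
apply: connected_continuous_connected; first exact: segment_connected.
apply/subspace_continuousP => l; rewrite /= in_itv /= => l01 V nV.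
have [cl hl] := hP l l01; have [d d0 Hd] := chart_ball ac cl nV.
suff : \forall l' \near l, 0 <= l' <= 1 -> V (h l').
  by apply: filterS => l' Vl'; rewrite /= in_itv /=.
near=> l' => l'01.
have [cl' hl'] := hP l' l'01.
have [||x [cx Vx xh]] := Hd (w l').
- by rewrite -hl'; apply: chart_corner.
- rewrite hl /w opprD addrACA subrr add0r -scalerBl normrZ.
  have : `|l' - l| < d / (`|cmap c z - cmap c y| + 1).
    near: l'; apply/nbhs_ballP; exists (d / (`|cmap c z - cmap c y| + 1)) => /=.
      by rewrite divr_gt0 // ltr_wpDl.
    by move=> s; rewrite -ball_normE /= distrC.
  rewrite ltr_pdivlMr; last by rewrite ltr_wpDl.
  by apply: le_lt_trans; rewrite ler_wpM2l // lerDl.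
by have -> : h l' = x by apply: (chart_inj ac) => //; rewrite hl'.
Unshelve. all: by end_near. Qed.
End ChartSegments.

(** * Differentials of transition maps and invariance of the depth *)

Section DirectionalDerivative.
Context {R : realType} {U V W : normedModType R}.
Implicit Types (f : U -> V) (g : V -> W).

Lemma derive_comp f g (x u : U) : differentiable f x -> differentiable g (f x) ->
  'D_u (g \o f) x = 'D_('D_u f x) g (f x).
Proof.
move=> df dg; rewrite !deriveE //; last exact: differentiable_comp.
by rewrite diff_comp.
Qed.

Lemma derive_linear f x a (u v : U) : differentiable f x ->
  'D_(a *: u + v) f x = a *: 'D_u f x + 'D_v f x.
Proof. by move=> df; rewrite !deriveE // linearP. Qed.

Lemma deriveB_dir f x (u v : U) : differentiable f x ->
  'D_(u - v) f x = 'D_u f x - 'D_v f x.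
Proof. by move=> df; rewrite !deriveE // linearB. Qed.
End DirectionalDerivative.

Section Transitions.
Context {R : realType} {n : nat} {M : manifold_with_faces R n}.
Implicit Types (c : chart R n M) (x y z : M) (F : set M) (J : {set 'I_n}).
Implicit Types (W : set 'rV[R]_n) (v : 'rV[R]_n) (g : 'rV[R]_n -> 'rV[R]_n).

Definition inward c x v := forall i, i \in zeroset c x -> 0 <= v 0 i.

Lemma transition_nbhs c x W : atlas c -> cdom c x -> open W -> W (cmap c x) ->
  \forall y \near x, cdom c y /\ W (cmap c y).
Proof.
move=> ac cx oW Wx.
have /nbhs_ballP[e /= e0 He] : nbhs (cmap c x) W by exact: open_nbhs_nbhs.
near=> y.
have [cy ye] : cdom c y /\ `|cmap c y - cmap c x| < e by near: y; apply: chart_near.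
by split=> //; apply: He; rewrite -ball_normE /= distrC.
Unshelve. all: by end_near. Qed.

Lemma transition_differentiable c c' x W g :
  W (cmap c x) -> transition_ext c c' W g -> differentiable g (cmap c x).
Proof. by move=> Wx [oW sg _]; apply: smooth_differentiable Wx. Qed.

(** An extension [g] is known to agree with the change of charts only at coordinates of points of
    [M]. Short inward rays consist of such coordinates. *)
Lemma transition_ray c c' x v W g (P : set M) : atlas c -> atlas c' ->
  cdom c x -> cdom c' x -> W (cmap c x) -> transition_ext c c' W g ->
  inward c x v -> nbhs x P ->
  \forall t \near (0 : R)^'+, exists z,
    [/\ P z, cdom c z, cdom c' z, cmap c z = cmap c x + t *: v &
        g (cmap c x + t *: v) = cmap c' z].
Proof.
move=> ac ac' cx c'x Wx [oW _ gP] vin nP.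
have near_x : \forall z \near x, [/\ P z, cdom c' z & W (cmap c z)].
  near=> z; split; first by near: z.
    by have [] : cdom c' z /\ `|cmap c' z - cmap c' x| < 1 by near: z; apply: chart_near.
  by have [] : cdom c z /\ W (cmap c z) by near: z; apply: transition_nbhs.
have := chart_ray ac cx vin near_x; apply: filterS => t [z [cz [Pz c'z Wz] zt]].
by exists z; split=> //; rewrite -zt gP.
Unshelve. all: by end_near. Qed.

Lemma transition_inward c c' x W g v : atlas c -> atlas c' ->
  cdom c x -> cdom c' x -> W (cmap c x) -> transition_ext c c' W g ->
  inward c x v -> inward c' x ('D_v g (cmap c x)).
Proof.
move=> ac ac' cx c'x Wx ext vin i iZ.
have dg := transition_differentiable Wx ext.
apply: derive_coord_ge0; first exact: diff_derivable.
have [_ _ gP] := ext; rewrite gP //; have [ir xi] := zerosetP _ _ _ iZ.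
have nT : nbhs x setT by exact: filterT.
have := transition_ray ac ac' cx c'x Wx ext vin nT.
by apply: filterS => t [z [_ _ c'z _ ->]]; rewrite xi (chart_corner ac' c'z ir).
Qed.

(** Along inward rays [g'] undoes [g], so the differentials compose to the identity on inward
    vectors. Every [v] is the difference of its positive and negative parts, both inward, and the
    differentials are linear. *)
Lemma transition_inverse c c' x W g W' g' v : atlas c -> atlas c' ->
  cdom c x -> cdom c' x -> W (cmap c x) -> transition_ext c c' W g ->
  W' (cmap c' x) -> transition_ext c' c W' g' ->
  'D_('D_v g (cmap c x)) g' (cmap c' x) = v.
Proof.
move=> ac ac' cx c'x Wx ext W'x ext'.
have dg := transition_differentiable Wx ext.
have dg' := transition_differentiable W'x ext'.
have [[oW _ gP] [oW' _ gP']] := (ext, ext').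
have gx : g (cmap c x) = cmap c' x by rewrite gP.
have dg'x : differentiable g' (g (cmap c x)) by rewrite gx.
have inv u : inward c x u -> 'D_('D_u g (cmap c x)) g' (cmap c' x) = u.
  move=> uin; have dcomp := differentiable_comp dg dg'x.
  have := derive_comp u dg dg'x; rewrite gx => <-.
  apply: derive_right_id; first exact: diff_derivable.
    by rewrite /= gx gP'.
  have := transition_ray ac ac' cx c'x Wx ext uin (transition_nbhs ac' c'x oW' W'x).
  apply: filterS => t [z [[_ W'z] cz c'z zt gt]].
  by rewrite /= gt gP'.
pose u s : 'rV[R]_n := \row_i Num.max (s * v 0 i) 0.
have vE : v = u 1 - u (-1).
  apply/rowP => i; rewrite !mxE mul1r mulN1r.
  by case: (leP (v 0 i) 0) => ?; case: (leP (- v 0 i) 0) => ?; lra.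
have uin s : inward c x (u s) by move=> i _; rewrite mxE le_max lexx orbT.
rewrite vE (deriveB_dir _ _ dg).
have dg'' : differentiable g' (cmap c' x) by rewrite -gx.
by rewrite (deriveB_dir _ _ dg'') (inv _ (uin 1)) (inv _ (uin (-1))).
Qed.

End Transitions.

Lemma lker_cancel {K : fieldType} {V : vectType K} (f : {linear V -> V}) (f' : V -> V) :
  cancel f f' -> lker (linfun f) = 0%VS.
Proof.
move=> fK; apply/eqP; rewrite -subv0; apply/subvP => v.
rewrite memv_ker lfunE /= => /eqP fv.
by rewrite memv0 -[v]fK fv -{1}(linear0 f) fK.
Qed.

Lemma coord_space_dim_le {K : fieldType} {n} (J J' : {set 'I_n})
    (f f' : 'rV[K]_n -> 'rV[K]_n) :
  (forall a u v, f (a *: u + v) = a *: f u + f v) -> cancel f f' ->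
  (forall v, v \in coord_space J -> f v \in coord_space J') ->
  (n - #|J| <= n - #|J'|)%N.
Proof.
move=> flin fK fJ.
pose fM := GRing.isLinear.Build _ _ _ _ f flin.
pose fL : {linear _ -> _} := HB.pack f fM.
rewrite -!(@dim_coord_space K) -(@limg_dim_eq _ _ _ (linfun fL)).
  apply: dimvS; apply/subvP => _ /memv_imgP[v vJ ->].
  by rewrite lfunE; apply: fJ.
by rewrite (lker_cancel (f := fL) fK) capv0.
Qed.

Section Depth.
Context {R : realType} {n : nat} {M : manifold_with_faces R n}.
Implicit Types (c : chart R n M) (x y z : M) (F : set M) (J : {set 'I_n}).
Implicit Types (W : set 'rV[R]_n) (v : 'rV[R]_n) (g : 'rV[R]_n -> 'rV[R]_n).

(** A vector vanishing on the zero set is inward together with its negative, so its image and the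
    negative of its image are inward too. *)
Lemma transition_tangent_stratum c c' x W g v : atlas c -> atlas c' ->
  cdom c x -> cdom c' x -> W (cmap c x) -> transition_ext c c' W g ->
  v \in coord_space (zeroset c x) ->
  'D_v g (cmap c x) \in coord_space (zeroset c' x).
Proof.
move=> ac ac' cx c'x Wx ext /memv_coord_space vZ.
have dg := transition_differentiable Wx ext.
apply/memv_coord_space => i iZ; apply/le_anti/andP; split; last first.
  by apply: (transition_inward ac ac' cx c'x Wx ext) iZ => j jZ; rewrite vZ.
have vN : inward c x (0 - v) by move=> j jZ; rewrite !mxE vZ // subrr.
have := transition_inward ac ac' cx c'x Wx ext vN iZ.
rewrite (deriveB_dir _ _ dg).
have -> : 'D_0 g (cmap c x) = 0.
  by rewrite -[X in 'D_X g _](subrr v) (deriveB_dir _ _ dg) subrr.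
by rewrite !mxE sub0r oppr_ge0.
Qed.

(** The injective differential maps the tangent space of the stratum in one chart into that in the
    other, and the dimensions are [n] minus the depths. *)
Lemma card_zeroset_le c c' x : atlas c -> atlas c' -> cdom c x -> cdom c' x ->
  (#|zeroset c' x| <= #|zeroset c x|)%N.
Proof.
move=> ac ac' cx c'x.
have [W [g [Wx ext]]] := atlas_compatible ac ac' cx c'x.
have [W' [g' [W'x ext']]] := atlas_compatible ac' ac c'x cx.
have dg := transition_differentiable Wx ext.
have := coord_space_dim_le (fun a u v => derive_linear a u v dg)
  (fun v => transition_inverse v ac ac' cx c'x Wx ext W'x ext')
  (fun v => transition_tangent_stratum ac ac' cx c'x Wx ext).
have := max_card (zeroset c x); have := max_card (zeroset c' x).
rewrite card_ord; lia.
Qed.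

Lemma stratumE c x k : atlas c -> cdom c x ->
  stratum M k x <-> #|zeroset c x| = k.
Proof.
move=> ac cx; split=> [/(_ c ac cx) //|<- c' ac' c'x].
by apply/eqP; rewrite eqn_leq !card_zeroset_le.
Qed.
End Depth.

(** * Faces as coordinate sheets *)

Lemma connected_locally_constant {T : topologicalType} (A : set T) (P : T -> Prop) :
  connected A ->
  (forall y, A y -> \forall z \near y, A z -> (P y <-> P z)) ->
  forall y z, A y -> A z -> P y -> P z.
Proof.
move=> cA locP y z Ay Az Py.
suff AP : A `&` [set x | P x] = A by move: Az; rewrite -AP => -[].
apply: cA; first by exists y.
- exists [set x | A x -> P x]°; first exact: open_interior.
  apply/seteqP; split=> x [Ax Px]; split=> //.
    by have := locP x Ax; apply: filterS => w PP Aw; apply/PP.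
  exact: (interior_subset Px).
- exists (~` [set x | A x -> ~ P x]°); first exact/open_closedC/open_interior.
  apply/seteqP; split=> x [Ax Px]; split=> //.
    by move=> /interior_subset; apply.
  apply: contrapT => nPx; apply: Px.
  by have := locP x Ax; apply: filterS => w PP Aw Pw; apply: nPx; apply/PP.
Qed.

Section FacesOfManifold.
Context {R : realType} {n : nat} {M : manifold_with_faces R n}.
Implicit Types (c : chart R n M) (x y z : M) (U : set M) (J : {set 'I_n}).
Implicit Types (F G H : face M).

Notation component k x := (connected_component (stratum M k) x).

Lemma face_eq F G : fcodim F = fcodim G -> fcar F = fcar G -> F = G.
Proof.
case: F => k A fA; case: G => k' A' fA' /= kk AA.
by subst; rewrite (Prop_irrelevance fA fA').
Qed.

Lemma face_closed F : closed (fcar F).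
Proof. by have [x _ ->] := faceP F; apply: closed_closure. Qed.

(** In a coordinate ball, points with equal zero sets are joined by a coordinate segment, and convex
    combinations keep positive coordinates positive and zero ones zero. *)
Lemma sheet_nbhs c x : atlas c -> cdom c x -> exists U, [/\ nbhs x U,
  forall y, U y -> cdom c y /\ zeroset c y \subset zeroset c x &
  forall y z, U y -> U z -> zeroset c y = zeroset c z ->
    component #|zeroset c y| y z].
Proof.
move=> ac cx; have nT : nbhs x setT by exact: filterT.
have [e e0 He] := chart_ball ac cx nT.
exists [set y | `|cmap c y - cmap c x| < e /\
  (cdom c y /\ zeroset c y \subset zeroset c x)]; split.
- near=> y; split; last by near: y; apply: zeroset_near.
  by have [] : cdom c y /\ `|cmap c y - cmap c x| < e by near: y; apply: chart_near.
- by move=> y [].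
move=> y z [ye [cy _]] [ze [cz _]] yz.
have surj w : corner (crank c) w -> `|w - cmap c x| < e ->
    exists2 u, cdom c u & cmap c u = w.
  by move=> cw we; have [u [cu _ uw]] := He w cw we; exists u.
have conn := chart_segment_connected ac surj cy cz ye ze.
apply: (connected_component_max _ _ conn).
- by split=> //; exists 0; rewrite ?lexx ?ler01 // scale0r addr0.
- move=> u [cu [l /andP[l0 l1] ul]]; apply/(stratumE _ ac cu); congr (#|pred_of_set _|).
  apply/setP => i; apply/idP/idP => [iu|iy].
    have [ir ui] := zerosetP _ _ _ iu; apply: contraT => iy.
    have ypos := zeroset_pos ac cy ir iy.
    have zpos : 0 < cmap c z 0 i by apply: zeroset_pos; rewrite -?yz.
    by move: ui; rewrite ul !mxE => ?; nra.
  have iz : i \in zeroset c z by rewrite -yz.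
  have [[ir yi] [_ zi]] := (zerosetP _ _ _ iy, zerosetP _ _ _ iz).
  by apply/zerosetP; split=> //; rewrite ul !mxE yi zi; ring.
- by split=> //; exists 1; rewrite ?lexx ?ler01 // scale1r addrC subrK.
Unshelve. all: by end_near. Qed.

(** The face is the closure of the component of a point [y0] near [x] with zero set [J]. Nearby
    points of the sheet are limits of points with zero set [J], which lie in that component by
    [sheet_nbhs]. *)
Lemma sheet_face c x J : atlas c -> cdom c x -> J \subset zeroset c x ->
  exists2 G, fcodim G = #|J| & \forall y \near x, J \subset zeroset c y -> fcar G y.
Proof.
move=> ac cx JZ; have [U [nU UZ Ucomp]] := sheet_nbhs ac cx.
have [y0 [cy0 Uy0 y0J]] := sheet_dense ac cx JZ nU.
have sy0 : stratum M #|J| y0 by apply/(stratumE _ ac cy0); rewrite y0J.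
exists (Face (ex_intro2 _ _ y0 sy0 erefl)) => //=.
near=> y => JZy V nV.
have nUy : nbhs y U by near: y; apply: nbhs_interior.
have cy : cdom c y by have [] := UZ y (nbhs_singleton nUy).
have [z [cz [Vz Uz] zJ]] := sheet_dense ac cy JZy (filterI nV nUy).
by exists z; split=> //; rewrite -y0J; apply: Ucomp => //; rewrite y0J.
Unshelve. all: by end_near. Qed.

(** Components are closed in their stratum: near [y], points of the same depth have the zero set of
    [y] and hence lie in its component. *)
Lemma closure_component k x y :
  closure (component k x) y -> stratum M k y -> component k x y.
Proof.
move=> + sy.
have [c ac cy] := atlas_cover y; have [U [nU UZ Ucomp]] := sheet_nbhs ac cy.
move=> /(_ U nU) [z [xz Uz]].
have [cz zZ] := UZ z Uz; have Uy := nbhs_singleton nU.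
have sz : stratum M k z by apply: connected_component_sub xz.
have zy : zeroset c z = zeroset c y.
  apply/eqP; rewrite eqEcard zZ /=.
  by rewrite (proj1 (stratumE _ ac cz) sz) (proj1 (stratumE _ ac cy) sy).
have := Ucomp z y Uz Uy zy; rewrite (proj1 (stratumE _ ac cz) sz).
exact: connected_component_trans.
Qed.

Lemma face_component F y : fcar F y -> stratum M (fcodim F) y ->
  fcar F = closure (component (fcodim F) y).
Proof.
have [x _ ->] := faceP F => xy sy.
by rewrite (same_connected_component (closure_component xy sy)).
Qed.

Lemma zeroset_stratum_near c x k : atlas c -> cdom c x -> stratum M k x ->
  \forall y \near x, cdom c y /\ (stratum M k y -> zeroset c y = zeroset c x).
Proof.
move=> ac cx sx; have := zeroset_near ac cx; apply: filterS => y [cy yZ].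
split=> // sy; apply/eqP; rewrite eqEcard yZ /=.
by rewrite (proj1 (stratumE _ ac cy) sy) (proj1 (stratumE _ ac cx) sx).
Qed.

(** On a stratum the zero set is locally constant, and near a point of [A] membership is decided by
    coordinates in this zero set; so [A] is open as well as closed in the component. *)
Lemma locally_cut_component (A : set M) k x : closed A ->
  (forall y c, A y -> atlas c -> cdom c y -> exists J, locally_cut c y A J) ->
  stratum M k x -> A x -> component k x `<=` A.
Proof.
move=> clA cutA sx Ax z xz.
apply: (connected_locally_constant (@component_connected _ (stratum M k) x) _ _ xz Ax);
  last exact: connected_component_refl.
move=> y xy; have sy : stratum M k y by apply: connected_component_sub xy.
have [Ay|nAy] := pselect (A y); last first.
  have : nbhs y (~` A) by apply: open_nbhs_nbhs; split=> //; apply: closed_openC.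
  by apply: filterS => w nAw _.
have [c ac cy] := atlas_cover y; have [J [JZ cutJ]] := cutA y c Ay ac cy.
near=> w => xw; split=> // _.
have sw : stratum M k w by apply: connected_component_sub xw.
have -> : A w <-> (forall j, j \in J -> cmap c w 0 j = 0) by near: w.
have [cw /(_ sw) wy] : cdom c w /\ (stratum M k w -> zeroset c w = zeroset c y).
  by near: w; apply: zeroset_stratum_near.
by move=> j /(fintype.subsetP JZ); rewrite -wy => /zerosetP[].
Unshelve. all: by end_near. Qed.

(** A point near [x] with zero set exactly one cut set lies in [A], so the coordinates of the other
    cut set vanish there as well. *)
Lemma locally_cut_uniq c x (A : set M) J J' : atlas c -> cdom c x ->
  locally_cut c x A J -> locally_cut c x A J' -> J = J'.
Proof.
move=> ac cx.
suff sub J1 J2 : locally_cut c x A J1 -> locally_cut c x A J2 -> J2 \subset J1.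
  by move=> cJ cJ'; apply/eqP; rewrite finset.eqEsubset !sub.
move=> [J1Z cut1] [J2Z cut2].
have [z [cz [z1 z2] zJ]] := sheet_dense ac cx J1Z (filterI cut1 cut2).
have Az : A z by apply/z1 => j; rewrite -zJ => /zerosetP[].
apply/fintype.subsetP => j jJ; rewrite -zJ; apply/zerosetP; split.
  by have /zerosetP[] := fintype.subsetP J2Z j jJ.
by move/z2 : Az; apply.
Qed.

(* Through every boundary coordinate at x passes one hypersurface, which near x is
   the sheet of this coordinate because it is embedded. *)
Lemma hypersurface_labels c x : atlas c -> cdom c x ->
  exists H : 'I_n -> face M,
    [/\ forall j, j \in zeroset c x -> fcodim (H j) = 1%N &
       \forall y \near x, forall j, j \in zeroset c x ->
         (fcar (H j) y <-> j \in zeroset c y)].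
Proof.
move=> ac cx.
have /choice[H HP] (j : 'I_n) : exists G : face M, j \in zeroset c x ->
    fcodim G = 1%N /\ \forall y \near x, [set j]%SET \subset zeroset c y -> fcar G y.
  have [jZ|] := boolP (j \in zeroset c x); last first.
    (* For coordinates outside the zero set of [x] any face will do as a default value. *)
    move=> _; have [x0 sx0 _] : exists2 x0, stratum M #|zeroset c x| x0 & True.
      by exists x => //; apply/(stratumE _ ac cx).
    by exists (Face (ex_intro2 _ _ x0 sx0 erefl)).
  have [|G codG nearG] := sheet_face ac cx (J := [set j]%SET); first by rewrite finset.sub1set.
  by exists G => _; rewrite codG cards1.
exists H; split=> [j jZ|]; first by have [] := HP j jZ.
apply: filter_forall => j; have [jZ|_] := boolP (j \in zeroset c x); last by near=> y.
have [codH nearH] := HP j jZ.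
have Hface : is_face_of (atlas (m := M)) 1 (fcar (H j)).
  by rewrite -codH; apply: faceP.
have Hx : fcar (H j) x by apply: (nbhs_singleton nearH); rewrite finset.sub1set.
have [j' [j'Z cutH]] := m_embedded Hface Hx ac cx.
have j'r : (j' < crank c)%N by move: j'Z; rewrite finset.sub1set => /zerosetP[].
(* Embeddedness yields some coordinate [j']; a point of the face with zero set exactly [[set j]]
   forces it to be [j]. *)
have j'j : j' = j.
  have jZ1 : [set j]%SET \subset zeroset c x by rewrite finset.sub1set.
  have [z [cz [zH zcut] zJ]] := sheet_dense ac cx jZ1 (filterI nearH cutH).
  have Hz : fcar (H j) z by apply: zH; rewrite zJ.
  apply/eqP; rewrite -finset.in_set1 -zJ; apply/zerosetP; split=> //.
  by move/zcut : Hz; apply; rewrite finset.in_set1.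
near=> y => _.
have -> : fcar (H j) y <-> forall i, i \in [set j']%SET -> cmap c y 0 i = 0 by near: y.
rewrite j'j; split=> [y0|/zerosetP[_ y0] i]; last by rewrite finset.in_set1 => /eqP ->.
by apply/zerosetP; split; [rewrite -j'j|apply: y0; rewrite finset.in_set1].
Unshelve. all: by end_near. Qed.

(** The component defining [F] could a priori return to [x] along several sheets. The hypersurfaces
    exclude this: one that meets the component contains all of it, so the zero set of [y0] is
    contained in that of every point of the component near [x]. *)
Lemma face_cut F c x : fcar F x -> atlas c -> cdom c x ->
  exists J, #|J| = fcodim F /\ locally_cut c x (fcar F) J.
Proof.
move=> Fx ac cx; have [x0 sx0 FE] := faceP F.
have [H [codH labels]] := hypersurface_labels ac cx.
have [U [nU UZ Ucomp]] := sheet_nbhs ac cx.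
have [y0 [xy0 [Uy0 lab0]]] : (component (fcodim F) x0 `&` (U `&` [set y | forall j,
    j \in zeroset c x -> (fcar (H j) y <-> j \in zeroset c y)])) !=set0.
  by move: Fx; rewrite FE => /(_ _ (filterI nU labels)).
have [cy0 y0Z] := UZ y0 Uy0.
have sy0 : stratum M (fcodim F) y0 by apply: connected_component_sub xy0.
have codF := proj1 (stratumE _ ac cy0) sy0.
exists (zeroset c y0); split=> //; split=> //.
near=> y.
have nUy : nbhs y U by near: y; apply: nbhs_interior.
have nlab : nbhs y [set z | forall j,
    j \in zeroset c x -> (fcar (H j) z <-> j \in zeroset c z)].
  by near: y; apply: nbhs_interior.
have [cy yZ] := UZ y (nbhs_singleton nUy).
split=> [|y_J].
  (* A point [y] of [F] near [x] is approached by points [y1] of the component; coordinates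
     vanishing at [y0] vanish at [y1], hence at [y]. *)
  rewrite FE => /(_ _ (filterI (zeroset_near ac cy) (filterI nUy nlab))).
  move=> [y1 [xy1 [[cy1 y1y] [Uy1 lab1]]]].
  have sy1 : stratum M (fcodim F) y1 by apply: connected_component_sub xy1.
  have HH j : j \in zeroset c x -> fcar (H j) y0 -> fcar (H j) y1.
    move=> jZ Hy0; have cutH w d : fcar (H j) w -> atlas d -> cdom d w ->
        exists J, locally_cut d w (fcar (H j)) J.
      move=> Hw ad dw; have Hface : is_face_of (atlas (m := M)) 1 (fcar (H j)).
        by rewrite -(codH j jZ); apply: faceP.
      by have [i ?] := m_embedded Hface Hw ad dw; exists [set i]%SET.
    have y01 : component (fcodim F) y0 y1.
      by rewrite -(same_connected_component xy0).
    exact: (locally_cut_component (face_closed (F := H j)) cutH sy0 Hy0 y01).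
  move=> j jy0; have jZ := fintype.subsetP y0Z j jy0.
  have jy1 : j \in zeroset c y1 by apply/(lab1 j jZ)/HH => //; apply/(lab0 j jZ).
  by have /zerosetP[] := fintype.subsetP y1y j jy1.
have Jy : zeroset c y0 \subset zeroset c y.
  apply/fintype.subsetP => j jy0; apply/zerosetP; split; last exact: y_J.
  by have /zerosetP[] := jy0.
rewrite FE => V nV.
have [z [cz [Vz Uz] zJ]] := sheet_dense ac cy Jy (filterI nV nUy).
exists z; split=> //; rewrite (same_connected_component xy0) -codF.
by apply: Ucomp.
Unshelve. all: by end_near. Qed.

(** Since [F] is locally a sheet, it absorbs the component of a point of the open stratum of [G],
    and being closed also the closure of that component. *)
Lemma face_sub G F x : stratum M (fcodim G) x -> fcar G x -> fcar F x ->
  fcar G `<=` fcar F.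
Proof.
move=> sx Gx Fx; rewrite (face_component Gx sx).
rewrite ((closure_id _).1 (face_closed (F := F))); apply: closureS.
apply: locally_cut_component => //; first exact: face_closed.
by move=> y c Fy ac cy; have [J [_ ?]] := face_cut Fy ac cy; exists J.
Qed.

Lemma fcodim_le F : (fcodim F <= n)%N.
Proof.
have [x sx _] := faceP F; have [c ac cx] := atlas_cover x.
by rewrite -(proj1 (stratumE _ ac cx) sx) -[leqRHS]card_ord max_card.
Qed.

(** Near each point every zero set belongs to at most one component, so only finitely many faces
    have open points there; compactness makes this global. *)
Lemma finite_faces k : finite_set [set F : face M | fcodim F = k].
Proof.
pose open_point F y := fcar F y /\ stratum M (fcodim F) y.
have /choice[U UP] x : exists U, nbhs x U /\
    finite_set [set F | fcodim F = k /\ exists2 y, U y & open_point F y].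
  have [c ac cx] := atlas_cover x; have [U [nU UZ Ucomp]] := sheet_nbhs ac cx.
  exists U; split=> //.
  pose B J := [set F | fcodim F = k /\ exists y, [/\ U y, open_point F y & zeroset c y = J]].
  apply: (@sub_finite_set _ _ (\bigcup_(J in [set: {set 'I_n}]) B J)).
    by move=> F [kF [y Uy Fy]]; exists (zeroset c y) => //; split=> //; exists y.
  apply: bigcup_finite => // J _.
  have [[F0 BF0]|noF] := pselect (exists F, B J F); last first.
    by rewrite (_ : B J = set0) // -subset0 => F BF; apply: noF; exists F.
  apply: (@sub_finite_set _ _ [set F0]) => // F [kF [y [Uy [Fy sy] yJ]]].
  have [kF0 [z [Uz [F0z sz] zJ]]] := BF0.
  apply: face_eq; first by rewrite kF.
  rewrite (face_component Fy sy) (face_component F0z sz) kF kF0; congr closure.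
  apply: same_connected_component.
  have [cy _] := UZ y Uy; have := Ucomp y z Uy Uz; rewrite yJ zJ => /(_ erefl).
  by rewrite -yJ (proj1 (stratumE _ ac cy) sy) kF.
pose D x := [set F | fcodim F = k /\ exists2 y, U x y & open_point F y].
(* In this filter a property is eventual when it holds for all sets of faces containing some finite
   one. Compactness in near-covering form then gives one finite set serving all points. *)
pose Fin := filter_from finite_set (fun A : set (face M) => [set B | A `<=` B]).
have FF : Filter Fin.
  apply: filter_from_filter; first by exists set0.
  move=> A B fA fB; exists (A `|` B); first by rewrite finite_setU.
  by move=> E AB; split=> G AG; apply: AB; [left|right].
have [x _|A fA Acover] := (compact_near_coveringP _).1 (m_compact (m := M)) _ Fin
  (fun A x => forall F, fcodim F = k -> open_point F x -> A F) FF.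
  have [nU fD] := UP x.
  exists (U x, [set B | D x `<=` B]); first by split=> //; exists (D x).
  by move=> [y A] [/= Uxy DA] F kF Fy; apply: DA; split=> //; exists y.
apply: (sub_finite_set _ fA) => F kF; have [y sy FE] := faceP F.
apply: (Acover A (fun _ => id) y) => //; split=> //.
by rewrite FE; apply/subset_closure/connected_component_refl.
Qed.

Lemma finite_fboundary F : finite_set (fboundary F).
Proof. by apply: sub_finite_set (finite_faces (fcodim F).+1) => G []. Qed.
End FacesOfManifold.

(** * Orientations and incidence numbers *)

Section Combinations.
Context {K : fieldType} {V : vectType K}.
Implicit Types (s t : seq V).

(** The shape of the new frame in [oval_det]. *)
Definition combine {m} (A : 'M[K]_m) s : seq V :=
  [seq \sum_(j < m) A i j *: s`_j | i <- enum 'I_m].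

Lemma size_combine {m} (A : 'M[K]_m) s : size (combine A s) = m.
Proof. by rewrite size_map size_enum_ord. Qed.

Lemma nth_combine {m} (A : 'M[K]_m) s (i : 'I_m) :
  (combine A s)`_i = \sum_(j < m) A i j *: s`_j.
Proof. by rewrite (nth_map i) ?size_enum_ord // nth_ord_enum. Qed.

Lemma free_combine m s t : size s = m -> size t = m -> free t ->
  {subset t <= span s} -> exists2 A : 'M[K]_m, A \in unitmx & t = combine A s.
Proof.
move=> sm tm free_t ts.
pose s' : m.-tuple V := Tuple (introT eqP sm).
pose t' : m.-tuple V := Tuple (introT eqP tm).
pose A : 'M[K]_m := \matrix_(i, j) coord s' j t'`_i.
have tE (i : 'I_m) : t`_i = \sum_(j < m) A i j *: s`_j.
  rewrite {1}(@coord_span _ _ _ s' t`_i); last by apply: ts; rewrite mem_nth ?tm.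
  by apply: eq_bigr => j _; rewrite mxE.
exists A; last first.
  apply: (@eq_from_nth _ 0) => [|i]; first by rewrite size_combine.
  by rewrite tm => im; rewrite (nth_combine A s (Ordinal im)) -tE.
rewrite -row_free_unit; apply: inj_row_free => u uA.
have free_t' : free t' by [].
apply/rowP => i; rewrite mxE.
have := @freeP _ _ _ t' free_t' (fun i => u 0 i); apply.
under eq_bigr do rewrite tE scaler_sumr.
rewrite exchange_big big1 //= => j _.
have : (u *m A) 0 j = 0 by rewrite uA mxE.
rewrite mxE => uAj.
by under eq_bigr do rewrite scalerA; rewrite -scaler_suml uAj scale0r.
Qed.

(** Two adapted frames differ in this way: the normal vector by a factor [l] and a tangential
    combination, the frame of the boundary by [A]. The determinant is [l] times that of [A]. *)
Lemma combine_block {m} (l : K) (b : 'rV[K]_m) (A : 'M[K]_m) (v : V) s :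
  combine (block_mx l%:M b 0 A : 'M[K]_(1 + m)) (v :: s)
  = (l *: v + \sum_(j < m) b 0 j *: s`_j) :: combine A s.
Proof.
set B := block_mx _ _ _ _.
have e0 : ord0 = lshift m (ord0 : 'I_1) by exact: val_inj.
have eR (i : 'I_m) : lift ord0 i = rshift 1 i by exact: val_inj.
have B00 : B ord0 ord0 = l by rewrite e0 block_mxEul mxE eqxx mulr1n.
have B0R j : B ord0 (lift ord0 j) = b 0 j.
  by rewrite eR e0 block_mxEur; congr (b _ _); apply: val_inj.
have BR0 i : B (lift ord0 i) ord0 = 0 by rewrite eR e0 block_mxEdl mxE.
have BRR i j : B (lift ord0 i) (lift ord0 j) = A i j by rewrite !eR block_mxEdr.
rewrite /combine enum_ordSl /= -map_comp big_ord_recl /= B00; congr (_ + _ :: _).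
  by apply: eq_bigr => j _; rewrite B0R.
apply: eq_map => i /=; rewrite big_ord_recl /= BR0 scale0r add0r.
by apply: eq_bigr => j _; rewrite BRR.
Qed.

Lemma combine_swap {m} (v w : V) s : size s = m ->
  combine (tperm_mx ord0 (lift ord0 ord0) : 'M[K]_m.+2) (v :: w :: s) = w :: v :: s.
Proof.
move=> sm; apply: (@eq_from_nth _ 0) => [|i]; first by rewrite size_combine /= sm.
rewrite size_combine => im; rewrite (nth_combine (tperm_mx _ _) _ (Ordinal im)).
rewrite (bigD1 (tperm ord0 (lift ord0 ord0) (Ordinal im))) //= big1 ?addr0; last first.
  by move=> j ji; rewrite !mxE eq_sym (negbTE ji) scale0r.
rewrite !mxE eqxx scale1r; case: i im => [|[|i]] im.
- have -> : Ordinal im = ord0 by exact: val_inj.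
  by rewrite tpermL.
- have -> : Ordinal im = lift ord0 ord0 by exact: val_inj.
  by rewrite tpermR.
by rewrite tpermD.
Qed.

Lemma free_map_inj (f f' : V -> V) s : (forall a u v, f (a *: u + v) = a *: f u + f v) ->
  cancel f f' -> free s -> free (map f s).
Proof.
move=> flin fK.
pose fM := GRing.isLinear.Build _ _ _ _ f flin.
pose fL : {linear _ -> _} := HB.pack f fM.
have -> : map f s = map (linfun fL) s by apply: eq_map => v; rewrite lfunE.
rewrite /free -limg_span size_map limg_dim_eq //.
by rewrite (lker_cancel (f := fL) fK) capv0.
Qed.
End Combinations.

Section Frames.
Context {R : realType} {n : nat} {M : manifold_with_faces R n}.
Implicit Types (c : chart R n M) (x y z : M) (J : {set 'I_n}).
Implicit Types (F G H : face M) (v : 'rV[R]_n) (s : seq 'rV[R]_n).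

Lemma fdimS F G : prec G F -> fdim F = (fdim G).+1.
Proof.
by move=> [_ codG]; rewrite /fdim codG -subSn ?subSS // -codG fcodim_le.
Qed.

Lemma card_cut F c x J : fcar F x -> atlas c -> cdom c x ->
  locally_cut c x (fcar F) J -> #|J| = fcodim F.
Proof.
move=> Fx ac cx cJ; have [J' [<- cJ']] := face_cut Fx ac cx.
by rewrite (locally_cut_uniq ac cx cJ cJ').
Qed.

Lemma tangentP F c x J v : atlas c -> cdom c x -> locally_cut c x (fcar F) J ->
  tangent c x F v <-> v \in coord_space J.
Proof.
move=> ac cx cJ; split=> [[J' cJ' v0]|/memv_coord_space v0]; last by exists J.
by apply/memv_coord_space; rewrite (locally_cut_uniq ac cx cJ cJ').
Qed.

(** At a nearby point with zero set exactly the cut set of [G], which lies in [G] and hence in [F],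
    the coordinates cutting [F] vanish. So the cut sets are nested, and the codimensions leave a
    single extra coordinate. *)
Lemma prec_cut F G c x : prec G F -> atlas c -> cdom c x -> fcar G x ->
  exists J a, [/\ a \notin J, locally_cut c x (fcar F) J &
    locally_cut c x (fcar G) (a |: J)%SET].
Proof.
move=> [GF codG] ac cx Gx; have Fx := GF x Gx.
have [J [cardJ cJ]] := face_cut Fx ac cx.
have [J' [cardJ' cJ']] := face_cut Gx ac cx.
have JJ' : J \subset J'.
  have [J'Z nearG] := cJ'; have [JZ nearF] := cJ.
  have [z [cz [zG zF] zJ]] := sheet_dense ac cx J'Z (filterI nearG nearF).
  have Gz : fcar G z by apply/zG => j; rewrite -zJ => /zerosetP[].
  apply/fintype.subsetP => j jJ; rewrite -zJ; apply/zerosetP; split.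
    by have /zerosetP[] := fintype.subsetP JZ j jJ.
  by move/zF : (GF z Gz); apply.
have : #|J' :\: J|%SET == 1%N.
  by rewrite cardsD (finset.setIidPr JJ') cardJ cardJ' codG subSnn.
case/cards1P => a Ja; exists J, a.
have aJ : a \in (J' :\: J)%SET by rewrite Ja finset.in_set1.
rewrite finset.in_setD in aJ; have /andP[aJ1 aJ'] := aJ; split=> //.
have -> // : (a |: J)%SET = J'.
apply/setP => j; rewrite finset.in_setU1.
have [jJ|jJ] := boolP (j \in J); first by rewrite orbT (fintype.subsetP JJ').
have : (j \in (J' :\: J)%SET) = (j == a) by rewrite Ja finset.in_set1.
by rewrite finset.in_setD jJ orbF /= => ->.
Qed.

Lemma frame_span F c x J s : fcar F x -> atlas c -> cdom c x ->
  locally_cut c x (fcar F) J -> is_frame c x F s -> span s = coord_space J.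
Proof.
move=> Fx ac cx cJ [size_s /eqP free_s tan_s].
apply/eqP; rewrite eqEdim dim_coord_space (card_cut Fx ac cx cJ) free_s size_s.
rewrite leqnn andbT; apply/span_subvP => v vs.
by apply/(tangentP _ ac cx cJ)/tan_s.
Qed.

Lemma frame_exists F c x : fcar F x -> atlas c -> cdom c x ->
  exists s, is_frame c x F s.
Proof.
move=> Fx ac cx; have [J [cardJ cJ]] := face_cut Fx ac cx.
exists (vbasis (coord_space J : {vspace 'rV[R]_n})); split.
- by rewrite size_tuple dim_coord_space cardJ.
- exact: (basis_free (vbasisP _)).
by move=> v /vbasis_mem vJ; apply/(tangentP _ ac cx cJ).
Qed.

Lemma frame_cons F G c x J a v s : prec G F -> fcar G x -> atlas c -> cdom c x ->
  locally_cut c x (fcar F) J -> locally_cut c x (fcar G) (a |: J)%SET ->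
  v \in coord_space J -> v 0 a != 0 -> is_frame c x G s -> is_frame c x F (v :: s).
Proof.
move=> GF Gx ac cx cJ caJ vJ va0 fr; have [size_s free_s tan_s] := fr; split.
- by rewrite /= size_s (fdimS GF).
- rewrite free_cons free_s andbT (frame_span Gx ac cx caJ fr).
  apply/negP => /memv_coord_space /(_ a); rewrite finset.setU11 => /(_ isT) /eqP.
  exact/negP.
move=> w; rewrite inE => /orP[/eqP ->|ws]; apply/(tangentP _ ac cx cJ) => //.
have /(tangentP _ ac cx caJ)/memv_coord_space w0 := tan_s w ws.
by apply/memv_coord_space => j jJ; apply: w0; rewrite finset.in_setU1 jJ orbT.
Qed.

Lemma oval_combine F (oF : orientation F) c x s m (A : 'M[R]_m) : m = fdim F ->
  atlas c -> cdom c x -> fcar F x -> is_frame c x F s -> A \in unitmx ->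
  oF c x (combine A s) = Num.sg (\det A) * oF c x s.
Proof. by move=> e; subst m; apply: oval_det. Qed.

Lemma oval_sqr F (oF : orientation F) c x s : atlas c -> cdom c x -> fcar F x ->
  is_frame c x F s -> oF c x s * oF c x s = 1.
Proof.
by move=> ac cx Fx fr; have [->|->] := oval_sign oF ac cx Fx fr; ring.
Qed.

Lemma oval_swap F (oF : orientation F) c x v w s : atlas c -> cdom c x -> fcar F x ->
  is_frame c x F (v :: w :: s) -> oF c x (w :: v :: s) = - oF c x (v :: w :: s).
Proof.
move=> ac cx Fx fr; have [size_s _ _] := fr.
rewrite -(combine_swap v w (erefl (size s))) oval_combine //.
  by rewrite det_perm odd_tperm /= expr1 sgrN1 mulN1r.
by rewrite unitmx_perm.
Qed.

(** Passing to the primed data multiplies the value on [F] by the sign of [l * \det A] and the value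
    on [G] by that of [\det A]. Both vectors point outward, so [l] is positive, and the signs of the
    determinant cancel in the product. *)
Lemma oval_outward_indep F G (oF : orientation F) (oG : orientation G) c x J a
    v v' s s' : prec G F -> fcar G x -> atlas c -> cdom c x ->
  locally_cut c x (fcar F) J -> locally_cut c x (fcar G) (a |: J)%SET ->
  v \in coord_space J -> v 0 a < 0 -> is_frame c x G s ->
  v' \in coord_space J -> v' 0 a < 0 -> is_frame c x G s' ->
  oF c x (v :: s) * oG c x s = oF c x (v' :: s') * oG c x s'.
Proof.
move=> GF Gx ac cx cJ caJ vJ va fr v'J v'a fr'.
have Fx : fcar F x by case: GF => + _; apply.
have frF : is_frame c x F (v :: s).
  by apply: frame_cons caJ vJ _ fr => //; rewrite lt_eqF.
have [[size_s free_s _] [size_s' free_s' _]] := (fr, fr').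
have span_s := frame_span Gx ac cx caJ fr.
have span_s' := frame_span Gx ac cx caJ fr'.
have [|A unitA s'E] := free_combine size_s size_s' free_s'.
  by move=> w ws; rewrite span_s -span_s' memv_span.
(* This factor removes the coordinate [a] from [v' - l *: v], which becomes tangent to [G]. *)
pose l := v' 0 a / v 0 a; have l0 : 0 < l by rewrite /l -mulrNN mulr_gt0 ?oppr_gt0 ?invr_lt0.
pose w := v' - l *: v; have : w \in span s.
  rewrite span_s; apply/memv_coord_space => j; rewrite finset.in_setU1 !mxE.
  move: vJ v'J => /memv_coord_space vJ /memv_coord_space v'J.
  case/orP => [/eqP ->|jJ]; first by rewrite /l divfK ?subrr // lt_eqF.
  by rewrite vJ // v'J // mulr0 subrr.
pose t : (fdim G).-tuple 'rV[R]_n := Tuple (introT eqP size_s).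
rewrite -[span s]/(span t) => /coord_span wE.
pose b : 'rV[R]_(fdim G) := \row_j coord t j w.
have v'E : v' :: s' = combine (block_mx l%:M b 0 A : 'M[R]_(1 + fdim G)) (v :: s).
  rewrite combine_block -s'E; congr (_ :: _).
  have -> : \sum_(j < fdim G) b 0 j *: s`_j = w.
    by rewrite [RHS]wE; apply: eq_bigr => j _; rewrite mxE.
  by rewrite addrC subrK.
have detB : \det (block_mx l%:M b 0 A : 'M[R]_(1 + fdim G)) = l * \det A.
  by rewrite det_ublock det_scalar1.
have detA : \det A != 0 by rewrite -unitfE -unitmxE.
rewrite v'E oval_combine //; first last.
- by rewrite unitmxE detB unitfE mulf_neq0 // gt_eqF.
- by rewrite (fdimS GF).
rewrite detB s'E oval_combine // sgrM gtr0_sg // mul1r mulrACA -expr2 sqr_sg detA.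
by rewrite mul1r.
Qed.
End Frames.

Lemma sign_parts {R : realType} {n} (v : 'rV[R]_n) : exists u w : 'rV[R]_n,
  [/\ v = u - w, forall i, 0 <= u 0 i /\ 0 <= w 0 i &
      forall i, v 0 i = 0 -> u 0 i = 0 /\ w 0 i = 0].
Proof.
exists (\row_i Num.max (v 0 i) 0), (\row_i Num.max (- v 0 i) 0); split.
- apply/rowP => i; rewrite !mxE.
  by case: (leP (v 0 i) 0) => ?; case: (leP (- v 0 i) 0) => ?; lra.
- by move=> i; rewrite !mxE !le_max lexx !orbT.
by move=> i v0; rewrite !mxE v0 oppr0 maxxx.
Qed.

Section Incidence.
Context {R : realType} {n : nat} {M : manifold_with_faces R n}.
Implicit Types (c : chart R n M) (x y z : M) (J : {set 'I_n}).
Implicit Types (F G H : face M) (v : 'rV[R]_n) (s : seq 'rV[R]_n).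
Implicit Types (W : set 'rV[R]_n) (g : 'rV[R]_n -> 'rV[R]_n).

(** For a tangent vector with nonnegative entries the ray from [x] stays in [F], where the
    coordinates of [J'] vanish, so their derivatives do. [sign_parts] reduces the general case to
    this one. *)
Lemma transition_tangent c c' x W g F J J' v : atlas c -> atlas c' ->
  cdom c x -> cdom c' x -> W (cmap c x) -> transition_ext c c' W g ->
  fcar F x -> locally_cut c x (fcar F) J -> locally_cut c' x (fcar F) J' ->
  v \in coord_space J -> 'D_v g (cmap c x) \in coord_space J'.
Proof.
move=> ac ac' cx c'x Wx ext Fx [JZ nJ] [J'Z nJ'] /memv_coord_space vJ.
have dg := transition_differentiable Wx ext.
have gx : g (cmap c x) = cmap c' x by have [_ _ ->] := ext.
have key (u : 'rV[R]_n) : (forall i, 0 <= u 0 i) -> (forall j, j \in J -> u 0 j = 0) ->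
    forall j, j \in J' -> 'D_u g (cmap c x) 0 j = 0.
  move=> u0 uJ j jJ'; have du : derivable g (cmap c x) u by exact: diff_derivable.
  apply: (derive_coord_eq0 du).
  have uin : inward c x u by move=> i _; apply: u0.
  have nJJ' : \forall y \near x,
      (fcar F y <-> forall j, j \in J -> cmap c y 0 j = 0) /\
      (fcar F y <-> forall j, j \in J' -> cmap c' y 0 j = 0) by exact: filterI.
  have := transition_ray ac ac' cx c'x Wx ext uin nJJ'.
  apply: filterS => t [z [[zJ zJ'] cz c'z zt ->]]; rewrite gx.
  have Fz : fcar F z.
    apply/zJ => i iJ; rewrite zt !mxE uJ // mulr0 addr0.
    by have /zerosetP[] := fintype.subsetP JZ i iJ.
  by rewrite (zJ'.1 Fz) // ((nbhs_singleton nJ').1 Fx).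
have [u [w [vE uw0 uwJ]]] := sign_parts v.
apply/memv_coord_space => j jJ'; rewrite vE (deriveB_dir _ _ dg) !mxE.
rewrite (key u) ?(key w) ?subrr // => i; try by have [] := uw0 i.
  by move=> iJ; have [] := uwJ i (vJ i iJ).
by move=> iJ; have [] := uwJ i (vJ i iJ).
Qed.

Lemma zeroset_open_cut G c x J : atlas c -> cdom c x -> fcar G x ->
  stratum M (fcodim G) x -> locally_cut c x (fcar G) J -> zeroset c x = J.
Proof.
move=> ac cx Gx sx cJ; apply/esym/eqP; rewrite eqEcard.
have [-> _] := cJ; rewrite (proj1 (stratumE _ ac cx) sx).
by rewrite (card_cut Gx ac cx cJ) leqnn.
Qed.

Lemma outwardP F c x J a v : atlas c -> cdom c x -> locally_cut c x (fcar F) J ->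
  zeroset c x = (a |: J)%SET ->
  outward c x F v <-> v \in coord_space J /\ v 0 a < 0.
Proof.
move=> ac cx cJ Z; split=> [[/(tangentP _ ac cx cJ) vJ [i iZ vi]]|[vJ va]].
  split=> //; move: iZ; rewrite Z finset.in_setU1 => /orP[/eqP <- //|iJ].
  by move: vi; rewrite ((memv_coord_space _ _ vJ) i iJ) ltxx.
split; first exact/(tangentP _ ac cx cJ).
by exists a => //; rewrite Z finset.setU11.
Qed.

Lemma locally_cut_near F c x J : atlas c -> cdom c x -> locally_cut c x (fcar F) J ->
  \forall y \near x, cdom c y /\ (fcar F y -> locally_cut c y (fcar F) J).
Proof.
move=> ac cx [JZ nJ]; near=> y.
have [cy _] : cdom c y /\ `|cmap c y - cmap c x| < 1 by near: y; apply: chart_near.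
split=> // Fy.
have nJy : \forall z \near y, fcar F z <-> (forall j, j \in J -> cmap c z 0 j = 0).
  by near: y; apply: nbhs_interior.
split=> //; apply/fintype.subsetP => j jJ; apply/zerosetP; split.
  by have /zerosetP[] := fintype.subsetP JZ j jJ.
by apply: (nbhs_singleton nJy).1.
Unshelve. all: by end_near. Qed.

Lemma frame_near G (oG : orientation G) c x s :
  fcar G x -> atlas c -> cdom c x -> is_frame c x G s ->
  \forall y \near x, cdom c y /\ (fcar G y -> is_frame c y G s /\ oG c y s = oG c x s).
Proof.
move=> Gx ac cx fr; have [J [_ cJ]] := face_cut Gx ac cx.
near=> y.
have [cy cJy] : cdom c y /\ (fcar G y -> locally_cut c y (fcar G) J).
  by near: y; apply: locally_cut_near.
split=> // Gy; have fry : is_frame c y G s.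
  have [size_s free_s tan_s] := fr; split=> // v /tan_s.
  by move=> /(tangentP _ ac cx cJ) vJ; apply/(tangentP _ ac cy (cJy Gy)).
split=> //; move: Gy fry; near: y.
exact: (oval_near oG ac cx Gx fr).
Unshelve. all: by end_near. Qed.
Section Pair.
Variables (F G : face M) (oF : orientation F) (oG : orientation G).
Hypothesis GF : prec G F.

Let FG x : fcar G x -> fcar F x. Proof. by case: GF => + _; apply. Qed.

(** The differential [L] of the change of charts carries the data from [c] to [c'] without changing
    either value; [oval_outward_indep] then compares frames in the single chart [c']. *)
Lemma oval_outward_chart c c' x v v' s s' : fcar G x -> stratum M (fcodim G) x ->
  atlas c -> cdom c x -> outward c x F v -> is_frame c x G s ->
  atlas c' -> cdom c' x -> outward c' x F v' -> is_frame c' x G s' ->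
  oF c x (v :: s) * oG c x s = oF c' x (v' :: s') * oG c' x s'.
Proof.
move=> Gx sx ac cx vout fr ac' c'x v'out fr'; have Fx := FG Gx.
have [J [a [aJ cJ caJ]]] := prec_cut GF ac cx Gx.
have [J' [a' [a'J' cJ' caJ']]] := prec_cut GF ac' c'x Gx.
have Z := zeroset_open_cut ac cx Gx sx caJ.
have Z' := zeroset_open_cut ac' c'x Gx sx caJ'.
have [vJ va] := (outwardP v ac cx cJ Z).1 vout.
have [v'J' v'a'] := (outwardP v' ac' c'x cJ' Z').1 v'out.
have frF : is_frame c x F (v :: s).
  by apply: frame_cons caJ vJ _ fr => //; rewrite lt_eqF.
have [W [g [Wx ext]]] := atlas_compatible ac ac' cx c'x.
have [W' [g' [W'x ext']]] := atlas_compatible ac' ac c'x cx.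
have dg := transition_differentiable Wx ext.
pose L u := 'D_u g (cmap c x).
have LK : cancel L (fun u => 'D_u g' (cmap c' x)).
  by move=> u; apply: transition_inverse Wx ext W'x ext'.
have LG u : u \in coord_space (a |: J)%SET -> L u \in coord_space (a' |: J')%SET.
  exact: transition_tangent Wx ext Gx caJ caJ'.
have LvJ' : L v \in coord_space J' by apply: transition_tangent Wx ext Fx cJ cJ' vJ.
(* [- v] is inward and so is its image, so [L v] points weakly outward. If its normal coordinate
   vanished, [L v] would be tangent to [G], and so would [v] by the inverse differential. *)
have Lva' : L v 0 a' < 0.
  rewrite lt_neqAle; apply/andP; split; last first.
    have vin : inward c x (0 - v).
      move=> i; rewrite Z finset.in_setU1 !mxE sub0r oppr_ge0.
      by case/orP=> [/eqP ->|iJ]; [apply: ltW|rewrite ((memv_coord_space _ _ vJ) i iJ)].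
    have := transition_inward ac ac' cx c'x Wx ext vin (i := a').
    rewrite Z' finset.setU11 (deriveB_dir _ _ dg) => /(_ isT).
    have -> : 'D_0 g (cmap c x) = 0.
      by rewrite -[X in 'D_X g _](subrr v) (deriveB_dir _ _ dg) subrr.
    by rewrite !mxE sub0r oppr_ge0.
  apply/eqP => Lv0; have : L v \in coord_space (a' |: J')%SET.
    apply/memv_coord_space => j; rewrite finset.in_setU1.
    by case/orP=> [/eqP -> //|]; apply: memv_coord_space.
  move=> /(transition_tangent ac' ac c'x cx W'x ext' Gx caJ' caJ).
  rewrite [X in X \in _]LK => /memv_coord_space /(_ a).
  by rewrite finset.setU11 => /(_ isT) va0; rewrite va0 ltxx in va.
have frL : is_frame c' x G (map L s).
  have [size_s free_s tan_s] := fr; split; first by rewrite size_map.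
    by apply: free_map_inj LK free_s => b u w; apply: derive_linear.
  move=> _ /mapP[u us ->]; apply/(tangentP _ ac' c'x caJ')/LG.
  by apply/(tangentP _ ac cx caJ)/tan_s.
rewrite -(oval_outward_indep oF oG GF Gx ac' c'x cJ' caJ' LvJ' Lva' frL v'J' v'a' fr').
have -> : oF c' x (L v :: map L s) = oF c x (v :: s).
  exact: (oval_chart oF ac ac' cx c'x Fx frF Wx ext).
have -> // : oG c' x (map L s) = oG c x s.
exact: (oval_chart oG ac ac' cx c'x Gx fr Wx ext).
Qed.

End Pair.
End Incidence.

Section IncidenceSigns.
Context {R : realType} {n : nat} {M : manifold_with_faces R n}.
Implicit Types (c : chart R n M) (x y z : M) (J : {set 'I_n}).
Implicit Types (F G H : face M) (v : 'rV[R]_n) (s : seq 'rV[R]_n).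

(** The product is locally constant on the open stratum of [G], since a frame and an outward vector
    can be kept fixed in a chart; the component making up this stratum is connected. *)
Lemma oval_outward_const F G (oF : orientation F) (oG : orientation G)
    c c' x x' v v' s s' : prec G F ->
  fcar G x -> stratum M (fcodim G) x -> atlas c -> cdom c x ->
  outward c x F v -> is_frame c x G s ->
  fcar G x' -> stratum M (fcodim G) x' -> atlas c' -> cdom c' x' ->
  outward c' x' F v' -> is_frame c' x' G s' ->
  oF c x (v :: s) * oG c x s = oF c' x' (v' :: s') * oG c' x' s'.
Proof.
move=> GF Gx sx ac cx vout fr Gx' sx' ac' c'x' v'out fr'.
pose A := connected_component (stratum M (fcodim G)) x.
have AG y : A y -> fcar G y.
  by move=> Ay; rewrite (face_component Gx sx); apply: subset_closure.
have As y : A y -> stratum M (fcodim G) y by apply: connected_component_sub.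
have Ax : A x by exact: connected_component_refl.
have Ax' : A x'.
  by apply: closure_component => //; rewrite -(face_component Gx sx).
(* Quantifying over all charts and frames makes this a property of the point alone; by
   [oval_outward_chart] one instance at each point decides it. *)
pose P y := forall d w r, atlas d -> cdom d y -> outward d y F w -> is_frame d y G r ->
  oF c x (v :: s) * oG c x s = oF d y (w :: r) * oG d y r.
suff : P x' by apply.
have Px : P x by move=> d w r ad dx wout frd; apply: oval_outward_chart.
apply: (connected_locally_constant (@component_connected _ _ x) _ Ax Ax' Px).
move=> y Ay; have [d ad dy] := atlas_cover y; have Gy := AG y Ay.
have [J [a [aJ cJ caJ]]] := prec_cut GF ad dy Gy.
have Zy := zeroset_open_cut ad dy Gy (As y Ay) caJ.
have [r frr] := frame_exists Gy ad dy.
pose w : 'rV[R]_n := - delta_mx 0 a.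
have wJ : w \in coord_space J.
  apply/memv_coord_space => j jJ; rewrite !mxE eqxx /=.
  by case: eqP => [ja|]; rewrite ?oppr0 //; rewrite -ja jJ in aJ.
have wa : w 0 a < 0 by rewrite !mxE !eqxx oppr_lt0 ltr01.
have Fy : fcar F y by case: GF => + _; apply.
have frF : is_frame d y F (w :: r).
  by apply: frame_cons caJ wJ _ frr => //; rewrite lt_eqF.
have wout : outward d y F w by apply/(outwardP w ad dy cJ Zy).
near=> z => Az; have Gz := AG z Az; have sz := As z Az.
have Fz : fcar F z by case: GF => + _; apply.
have [dz Zz] : cdom d z /\ (stratum M (fcodim G) z -> zeroset d z = zeroset d y).
  by near: z; apply: zeroset_stratum_near => //; apply: As.
have [_ /(_ Fz) cJz] : cdom d z /\ (fcar F z -> locally_cut d z (fcar F) J).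
  by near: z; apply: locally_cut_near.
have [_ /(_ Gz) [frz oGz]] : cdom d z /\
    (fcar G z -> is_frame d z G r /\ oG d z r = oG d y r).
  by near: z; apply: frame_near.
have [_ /(_ Fz) [frFz oFz]] : cdom d z /\
    (fcar F z -> is_frame d z F (w :: r) /\ oF d z (w :: r) = oF d y (w :: r)).
  by near: z; apply: frame_near.
have woutz : outward d z F w by apply/(outwardP w ad dz cJz (etrans (Zz sz) Zy)).
split=> PP d' w' r' ad' d'z w'out fr''.
  rewrite (PP d w r ad dy wout frr) -oFz -oGz.
  exact: (oval_outward_chart oF oG GF Gz sz ad dz woutz frz ad' d'z w'out fr'').
rewrite (PP d w r ad dz woutz frz) oFz oGz.
exact: (oval_outward_chart oF oG GF Gy (As y Ay) ad dy wout frr ad' d'z w'out fr'').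
Unshelve. all: by end_near. Qed.

Variable o : forall F : face M, orientation F.

(** [incidence] is 1 only if the orientations agree at every open point of [G]. As the product is
    constant, agreement at one point suffices, and disagreement leaves two opposite signs. *)
Lemma incidence_open F G c x v s : prec G F ->
  fcar G x -> stratum M (fcodim G) x -> atlas c -> cdom c x ->
  outward c x F v -> is_frame c x F (v :: s) -> is_frame c x G s ->
  incidence o F G = o F c x (v :: s) * o G c x s.
Proof.
move=> GF Gx sx ac cx vout frF fr; have Fx : fcar F x by case: GF => + _; apply.
have val_s := oval_sign (o G) ac cx Gx fr.
have val_vs := oval_sign (o F) ac cx Fx frF.
rewrite /incidence; case: asboolP => [agree|disagree].
  by rewrite (agree c x v s) // oval_sqr //.
have ne : o F c x (v :: s) != o G c x s.
  apply/eqP => eqv; apply: disagree => c' x' v' s' ac' c'x' Gx' sx' v'out fr'.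
  have := oval_outward_const (o F) (o G) GF Gx sx ac cx vout fr Gx' sx' ac' c'x' v'out fr'.
  rewrite eqv oval_sqr // => /(congr1 (fun r => r * o G c' x' s')).
  by rewrite mul1r -mulrA oval_sqr // mulr1.
by move: ne; case: val_s => ->; case: val_vs => ->; rewrite ?eqxx // ?mulr1 ?mul1r.
Qed.

(* The incidence number can be read off at every point of G, also where G meets
   smaller faces, because orientations are locally constant. *)
Lemma incidenceE F G c x J a v s : prec G F -> fcar G x -> atlas c -> cdom c x ->
  locally_cut c x (fcar F) J -> locally_cut c x (fcar G) (a |: J)%SET ->
  v \in coord_space J -> v 0 a < 0 -> is_frame c x G s ->
  incidence o F G = o F c x (v :: s) * o G c x s.
Proof.
move=> GF Gx ac cx cJ caJ vJ va fr; have Fx : fcar F x by case: GF => + _; apply.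
have frF : is_frame c x F (v :: s).
  by apply: frame_cons caJ vJ _ fr => //; rewrite lt_eqF.
have [aJZ nG] := caJ.
have near_x : \forall y \near x,
    [/\ fcar G y <-> forall j, j \in (a |: J)%SET -> cmap c y 0 j = 0,
        cdom c y /\ (fcar F y -> locally_cut c y (fcar F) J),
        cdom c y /\ (fcar G y -> is_frame c y G s /\ o G c y s = o G c x s) &
        cdom c y /\ (fcar F y -> is_frame c y F (v :: s) /\
          o F c y (v :: s) = o F c x (v :: s))].
  near=> y; split; near: y => //.
  - exact: locally_cut_near.
  - exact: frame_near.
  - exact: frame_near.
have [y [cy [Gy' [_ cJy] [_ fry] [_ frFy]] yJ]] := sheet_dense ac cx aJZ near_x.
have Gy : fcar G y by apply/Gy' => j; rewrite -yJ => /zerosetP[].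
have Fy : fcar F y by case: GF => + _; apply.
have [frGy <-] := fry Gy; have [frFy' <-] := frFy Fy.
apply: incidence_open => //; last by apply/(outwardP v ac cy (cJy Fy) yJ).
by apply/(stratumE _ ac cy); rewrite yJ (card_cut Gx ac cx caJ).
Unshelve. all: by end_near. Qed.

Lemma face_through_sheet c x J : atlas c -> cdom c x -> J \subset zeroset c x ->
  exists G, [/\ fcodim G = #|J|, fcar G x & locally_cut c x (fcar G) J].
Proof.
move=> ac cx JZ; have [G codG nG] := sheet_face ac cx JZ.
have Gx := nbhs_singleton nG JZ; exists G; split=> //.
have [J' [cardJ' cJ']] := face_cut Gx ac cx.
suff <- : J' = J by [].
apply/eqP; rewrite eqEcard cardJ' codG leqnn andbT.
have [J'Z nG'] := cJ'.
have [z [cz [zG zG'] zJ]] := sheet_dense ac cx JZ (filterI nG nG').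
have Gz : fcar G z by apply: zG; rewrite zJ.
apply/fintype.subsetP => j jJ'; rewrite -zJ; apply/zerosetP; split.
  by have /zerosetP[] := fintype.subsetP J'Z j jJ'.
by move/zG' : Gz; apply.
Qed.

Lemma cut_face_sub F G c x J J' : atlas c -> cdom c x -> fcar F x -> fcar G x ->
  locally_cut c x (fcar F) J -> locally_cut c x (fcar G) J' -> J \subset J' ->
  fcar G `<=` fcar F.
Proof.
move=> ac cx Fx Gx [_ nF] cJ' JJ'; have [J'Z nG] := cJ'.
have [z [cz [zF zG] zJ]] := sheet_dense ac cx J'Z (filterI nF nG).
apply: (@face_sub _ _ _ _ _ z).
- by apply/(stratumE _ ac cz); rewrite zJ (card_cut Gx ac cx cJ').
- by apply/zG => j; rewrite -zJ => /zerosetP[].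
- apply/zF => j jJ.
  by have := fintype.subsetP JJ' j jJ; rewrite -zJ => /zerosetP[].
Qed.

(* At a corner of H the tangent space of F has two normal coordinates a and b; the
   intermediate faces are the sheets of a and b, and both products of incidence numbers
   compare the orientations of F and H through the normals, in the orders (a, b) and
   (b, a). *)
Lemma incidence_cancel F H :
  fcar H `<=` fcar F -> fcodim H = (fcodim F).+2 ->
  \sum_(G \in [set G | prec H G /\ prec G F]) incidence o F G * incidence o G H = 0.
Proof.
move=> HF codH; have [x sx HE] := faceP H.
have Hx : fcar H x by rewrite HE; apply/subset_closure/connected_component_refl.
have Fx := HF x Hx; have [c ac cx] := atlas_cover x.
have [J [cardJ cJ]] := face_cut Fx ac cx; have [JZ _] := cJ.
have [JH [cardJH cH]] := face_cut Hx ac cx; have ZH := zeroset_open_cut ac cx Hx sx cH.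
have cZ : locally_cut c x (fcar H) (zeroset c x) by rewrite ZH.
have /cards2P[a [b [ab ZJ]]] : #|zeroset c x :\: J|%SET == 2%N.
  by rewrite cardsD (finset.setIidPr JZ) ZH cardJH cardJ codH -addn2 addKn.
have abZ i : (i \in zeroset c x) && (i \notin J) = (i == a) || (i == b).
  have := congr1 (fun A : {set 'I_n} => i \in A) ZJ.
  by rewrite finset.in_setD andbC finset.in_set2.
have aJ : a \notin J by have := abZ a; rewrite eqxx => /andP[].
have bJ : b \notin J by have := abZ b; rewrite eqxx orbT => /andP[].
have aZ : a \in zeroset c x by have := abZ a; rewrite eqxx => /andP[].
have bZ : b \in zeroset c x by have := abZ b; rewrite eqxx orbT => /andP[].
have sheet i : i \in zeroset c x -> i \notin J -> exists G,
    [/\ prec H G, prec G F, fcar G x & locally_cut c x (fcar G) (i |: J)%SET].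
  move=> iZ iJ; have iJZ : (i |: J)%SET \subset zeroset c x.
    by rewrite finset.subUset finset.sub1set iZ.
  have [G [codG Gx ciJ]] := face_through_sheet ac cx iJZ.
  rewrite cardsU1 iJ add1n cardJ in codG; exists G; split=> //; split; rewrite ?codG //.
    exact: (cut_face_sub ac cx Gx Hx ciJ cZ iJZ).
  by apply: (cut_face_sub ac cx Fx Gx cJ ciJ); rewrite finset.subsetU // subxx orbT.
have [Ga [HGa GaF Gax caJ]] := sheet a aZ aJ.
have [Gb [HGb GbF Gbx cbJ]] := sheet b bZ bJ.
have GaGb : Ga != Gb.
  apply/eqP => GG; rewrite GG in caJ; have := locally_cut_uniq ac cx caJ cbJ.
  move/setP/(_ a); rewrite finset.setU11 finset.in_setU1 (negbTE aJ) orbF.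
  by rewrite (negbTE ab).
have cut_eq G G' I : fcar G x -> fcar G' x -> locally_cut c x (fcar G) I ->
    locally_cut c x (fcar G') I -> G = G'.
  move=> Gx G'x cI cI'; apply: face_eq.
    by rewrite -(card_cut Gx ac cx cI) (card_cut G'x ac cx cI').
  by apply/seteqP; split; apply: (cut_face_sub ac cx _ _ _ _ (subxx _)); eassumption.
(* The cut set of an intermediate face is [J] with [a] or [b] added, and the cut set at [x]
   determines the face. *)
have -> : [set G | prec H G /\ prec G F] = [set` [:: Ga; Gb]].
  apply/seteqP; split=> G /=; last by rewrite !inE => /orP[/eqP->|/eqP->].
  move=> [HG GF]; have Gx : fcar G x by case: HG => + _; apply.
  have [J' [i [iJ' cJ' ciJ']]] := prec_cut GF ac cx Gx.
  have JJ' := locally_cut_uniq ac cx cJ' cJ; rewrite JJ' in iJ' ciJ'.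
  have iZ : i \in zeroset c x.
    by have [/fintype.subsetP + _] := ciJ'; apply; rewrite finset.setU11.
  have := abZ i; rewrite iZ iJ' !inE => /esym/orP[/eqP ia|/eqP ib].
    by rewrite (cut_eq G Ga (i |: J)%SET) ?eqxx //; rewrite ia.
  by rewrite (cut_eq G Gb (i |: J)%SET) ?eqxx ?orbT //; rewrite ib.
rewrite -fsbig_seq /=; last by rewrite !inE GaGb.
rewrite big_cons big_seq1.
have [s fr] := frame_exists Hx ac cx.
pose e (i : 'I_n) : 'rV[R]_n := - delta_mx 0 i.
have eJ (i : 'I_n) (I : {set 'I_n}) : i \notin I -> e i \in coord_space I.
  move=> iI; apply/memv_coord_space => j jI; rewrite !mxE eqxx /=.
  by case: eqP => [ji|]; rewrite ?oppr0 //; rewrite -ji jI in iI.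
have ei i : e i 0 i < 0 by rewrite !mxE !eqxx oppr_lt0 ltr01.
have en i : e i 0 i != 0 by rewrite lt_eqF.
have ZE i j : i != j -> i \in zeroset c x -> i \notin J ->
    j \in zeroset c x -> j \notin J -> zeroset c x = (j |: (i |: J))%SET.
  move=> ij iZ iJ jZ jJ; apply/esym/eqP; rewrite eqEcard; apply/andP; split.
    by rewrite !finset.subUset !finset.sub1set iZ jZ.
  rewrite !cardsU1 finset.in_setU1 negb_or eq_sym ij jJ iJ ZH cardJH codH cardJ.
  by rewrite !add1n.
(* The orientation of the intermediate face enters both incidence numbers and cancels as a square;
   only the order of the normals [e i], [e j] still depends on that face. *)
have product i j G : i != j -> i \in zeroset c x -> i \notin J ->
    j \in zeroset c x -> j \notin J -> prec H G -> prec G F -> fcar G x ->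
    locally_cut c x (fcar G) (i |: J)%SET ->
    is_frame c x F (e i :: e j :: s) /\
    incidence o F G * incidence o G H = o F c x (e i :: e j :: s) * o H c x s.
  move=> ij iZ iJ jZ jJ HG GF Gx ciJ.
  have jiJ : j \notin (i |: J)%SET by rewrite finset.in_setU1 negb_or eq_sym ij.
  have cH' : locally_cut c x (fcar H) (j |: (i |: J))%SET by rewrite -(ZE i j).
  have frG : is_frame c x G (e j :: s).
    exact: (frame_cons HG Hx ac cx ciJ cH' (eJ _ _ jiJ) (en j) fr).
  split; first exact: (frame_cons GF Gx ac cx cJ ciJ (eJ _ _ iJ) (en i) frG).
  rewrite (incidenceE GF Gx ac cx cJ ciJ (eJ _ _ iJ) (ei i) frG).
  rewrite (incidenceE HG Hx ac cx ciJ cH' (eJ _ _ jiJ) (ei j) fr).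
  by rewrite mulrA -[_ * _ * o G c x _]mulrA oval_sqr // mulr1.
have [frab ->] := product a b Ga ab aZ aJ bZ bJ HGa GaF Gax caJ.
have ba : b != a by rewrite eq_sym.
have [_ ->] := product b a Gb ba bZ bJ aZ aJ HGb GbF Gbx cbJ.
by rewrite -mulrDl (oval_swap _ ac cx Fx frab) subrr mul0r.
Qed.
End IncidenceSigns.

(** * Cartan calculus and transgression *)

Section FiniteSums.
Context {R : realType} {V W : lmodType R} {T : choiceType}.

Lemma linear_fsum (f : {linear V -> W}) (A : set T) (F : T -> V) :
  finite_set A -> f (\sum_(i \in A) F i) = \sum_(i \in A) f (F i).
Proof. by move=> fA; rewrite !fsbig_finite //= linear_sum. Qed.

Lemma scaler_fsuml (A : set T) (a : T -> R) (v : V) :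
  finite_set A -> (\sum_(i \in A) a i) *: v = \sum_(i \in A) a i *: v.
Proof. by move=> fA; rewrite !fsbig_finite //= scaler_suml. Qed.

Lemma scaler_fsumr (A : set T) (a : R) (F : T -> V) :
  finite_set A -> a *: (\sum_(i \in A) F i) = \sum_(i \in A) a *: F i.
Proof. by move=> fA; rewrite !fsbig_finite //= scaler_sumr. Qed.
End FiniteSums.

Section CartanCalculus.
Context {R : realType} {V : vector_fields R} {C : cartan V}.
Implicit Types x y : C.

Lemma cbideg0 q g : cbideg q g (0 : C).
Proof. by have [+ _ _] := @cbideg_grading _ _ C => /(_ (q, g))[]. Qed.

Lemma cbidegP q g a x y : cbideg q g x -> cbideg q g y -> cbideg q g (a *: x + y).
Proof.
by have [+ _ _] := @cbideg_grading _ _ C => /(_ (q, g))[_ +]; apply.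
Qed.

Lemma cbidegD q g x y : cbideg q g x -> cbideg q g y -> cbideg q g (x + y).
Proof. by rewrite -{2}[x]scale1r; apply: cbidegP. Qed.

Lemma cbidegZ q g a x : cbideg q g x -> cbideg q g (a *: x).
Proof. by move=> qx; rewrite -[_ *: _]addr0; apply: cbidegP (cbideg0 _ _). Qed.

Lemma cformP q a x y : cform q x -> cform q y -> cform q (a *: x + y).
Proof.
move=> [s [f fq ->]] [s' [f' f'q ->]].
(* The lists of degrees may repeat entries, so both sums are rewritten over one list without
   repetitions, weighted by multiplicities. *)
exists (undup (s ++ s')).
exists (fun g => a *: (f g *+ count_mem g s) + f' g *+ count_mem g s').
  move=> g; rewrite -scaler_nat -[f' g *+ _]scaler_nat.
  by apply: cbidegP; apply: cbidegZ.
have mults (r r' : seq int) (h : int -> C) : {subset r <= r'} ->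
    \sum_(g <- r) h g = \sum_(g <- undup r') h g *+ count_mem g r.
  move=> rr'; rewrite -big_undup_iterop_count /=.
  rewrite [RHS](bigID (mem r)) /= [X in _ + X]big1 ?addr0; last first.
    by move=> i ir; rewrite (count_memPn ir) mulr0n.
  rewrite -[RHS]big_filter; apply: perm_big.
  apply: uniq_perm; rewrite ?undup_uniq ?filter_uniq ?undup_uniq //.
  move=> g; rewrite mem_filter !mem_undup andb_idr //=; exact: rr'.
rewrite big_split /= -scaler_sumr -!mults // => g gs; rewrite mem_cat gs ?orbT //.
Qed.

Lemma cbideg_cform q g x : cbideg q g x -> cform q x.
Proof.
move=> qx; exists [:: g]; exists (fun h => if h == g then x else 0).
  by move=> h; case: eqP => [->//|_]; apply: cbideg0.
by rewrite big_seq1 eqxx.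
Qed.

Lemma cform0 q : cform q (0 : C).
Proof. exact: cbideg_cform (cbideg0 q 0). Qed.

Lemma cformZ q a x : cform q x -> cform q (a *: x).
Proof. by move=> qx; rewrite -[_ *: _]addr0; apply: cformP (cform0 _). Qed.

Lemma cformD q x y : cform q x -> cform q y -> cform q (x + y).
Proof. by rewrite -{2}[x]scale1r; apply: cformP. Qed.

Lemma cform_fsum {T : choiceType} q (A : set T) (F : T -> C) :
  finite_set A -> (forall i, A i -> cform q (F i)) -> cform q (\sum_(i \in A) F i).
Proof.
move=> fA FA; rewrite fsbig_finite //= big_seq.
elim/big_rec: _ => [|i x iA]; first exact: cform0.
by apply: cformD; apply: FA; move: iA; rewrite in_fset_set // inE.
Qed.

Lemma ciotaDl g (X Z : V g) x : ciota (X + Z) x = ciota X x + ciota Z x.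
Proof. by rewrite -[X in X + Z]scale1r ciota_lin scale1r. Qed.

Lemma ciota0l g x : ciota (0 : V g) x = 0.
Proof. by apply: (addrI (ciota (0 : V g) x)); rewrite -ciotaDl !addr0. Qed.

Lemma ciotaZl g a (X : V g) x : ciota (a *: X) x = a *: ciota X x.
Proof. by rewrite -[a *: X]addr0 ciota_lin ciota0l addr0. Qed.

Lemma clieDl g (X Z : V g) x : clie (X + Z) x = clie X x + clie Z x.
Proof. by rewrite /clie !ciotaDl linearD scalerDr addrACA. Qed.

Lemma clieZl g a (X : V g) x : clie (a *: X) x = a *: clie X x.
Proof. by rewrite /clie !ciotaZl linearZ scalerDr !scalerA [a * _]mulrC. Qed.

Lemma clie0l g x : clie (0 : V g) x = 0.
Proof. by rewrite /clie !ciota0l linear0 scaler0 addr0. Qed.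

Lemma clieD g (X : V g) x y : clie X (x + y) = clie X x + clie X y.
Proof. by rewrite /clie !linearD addrACA. Qed.

Lemma clieZ g (X : V g) a x : clie X (a *: x) = a *: clie X x.
Proof. by rewrite /clie !linearZ /= ?scalerDr ?scalerA [a * _]mulrC. Qed.

Lemma ciota_form0 g (X : V g) h x : cbideg 0 h x -> ciota X x = 0.
Proof. by move=> /(ciota_deg X); apply: cbideg_neg. Qed.

Lemma clie_cdel g (X : V g) x : clie X (cdel x) = ksgn g *: cdel (clie X x).
Proof.
by rewrite /clie cdel2 linear0 add0r linearD linearZ /= cdel2 scaler0 addr0.
Qed.

Lemma clie_iota1 (X Z : V 1) x :
  clie X (ciota Z x) = ciota Z (clie X x) + ciota (vbr X Z) x.
Proof.
by rewrite ciota_br subrr mulr0 /ksgn expr0z scale1r addrC subrK.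
Qed.

Lemma clieB g (X : V g) x y : clie X (x - y) = clie X x - clie X y.
Proof. by rewrite clieD -scaleN1r clieZ scaleN1r. Qed.

Lemma clie1E (X : V 1) x : clie X x = ciota X (cdel x) - cdel (ciota X x).
Proof. by rewrite /clie /ksgn expr1z scaleN1r. Qed.

Lemma cdel_clie1 (X : V 1) x : cdel (clie X x) = - clie X (cdel x).
Proof. by rewrite clie_cdel /ksgn expr1z scaleN1r opprK. Qed.

(** For [X = Z] the right side is twice the square of [clie X], so a degree-one field with vanishing
    self-bracket has a Lie derivative of square zero. *)
Lemma clie_br1 (X Z : V 1) x :
  clie (vbr X Z) x = clie X (clie Z x) + clie Z (clie X x).
Proof.
have br y : ciota (vbr X Z) y = clie X (ciota Z y) - ciota Z (clie X y).
  by rewrite clie_iota1 [RHS]addrC addKr.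
have k2 : ksgn (1 + 1) = 1 :> R by rewrite ksgnD ksgnK.
rewrite {1}/clie !br k2 scale1r linearB /= cdel_clie1.
rewrite [clie Z x]clie1E [clie Z (clie X x)]clie1E cdel_clie1 clieB linearN /=.
by rewrite addrACA.
Qed.
End CartanCalculus.

Lemma cform_linear {R : realType} {V V' : vector_fields R} {C : cartan V}
    {C' : cartan V'} (f : {linear C -> C'})
    (q q' : int) x :
  (forall g y, cbideg q g y -> exists g', cbideg q' g' (f y)) ->
  cform q x -> cform q' (f x).
Proof.
move=> fdeg [s [h hq ->]]; rewrite linear_sum /=.
elim/big_rec: _ => [|i y _]; first exact: cform0.
by apply: cformD; have [g' fh] := fdeg _ _ (hq i); exact: cbideg_cform fh.
Qed.

Lemma cdel_form {R : realType} {V : vector_fields R} {C : cartan V} q (x : C) :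
  cform q x -> cform (q + 1) (cdel x).
Proof. by apply: cform_linear => g y yq; exists g; apply: cdel_deg. Qed.

Section SourceCalculus.
Context {R : realType} {V : vector_fields R} {C : source_cartan V}.

Lemma dsrc_iota1 (X : V 1) (x : C) : ciota X (dsrc x) = dsrc (ciota X x).
Proof. by rewrite dsrc_iota subrr /ksgn expr0z scale1r. Qed.

Lemma cdel_dsrc (x : C) : cdel (dsrc x) = - dsrc (cdel x).
Proof. by rewrite dsrc_del opprK. Qed.

Lemma clie_dsrc1 (X : V 1) (x : C) : clie X (dsrc x) = - dsrc (clie X x).
Proof.
rewrite !clie1E cdel_dsrc linearN !dsrc_iota1 cdel_dsrc linearB /=.
by rewrite opprB opprK addrC.
Qed.
End SourceCalculus.

(** * Lifted vector fields, the transgression formula and the face total complex *)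

Section Forms.
Context {R : realType} {n : nat} {M : manifold_with_faces R n}
  {o : forall F : face M, orientation F} {Y : graded_manifold R}
  (S : mapping_spaces o Y).
Implicit Types (F G H : face M).

Lemma fint_iota1 F G (X : vect S F 1) x :
  ciota X (fint S F G x) = fint S F G (ciota X x).
Proof. by rewrite fint_iota subrr mul0r /ksgn expr0z scale1r. Qed.

Lemma iter_fint_iota1 F G (X : vect S F 1) k x :
  iter k (ciota X) (fint S F G x) = fint S F G (iter k (ciota X) x).
Proof. by elim: k => //= k ->; rewrite fint_iota1. Qed.

Lemma fint_cdel F G x :
  fint S F G (cdel x) = (-1) ^+ fdim G *: cdel (fint S F G x).
Proof. by rewrite fint_del scalerA -expr2 sqrr_sign scale1r. Qed.

Lemma ev0 F h : ev S F (0 : gform (gfun Y) 0 h) = 0.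
Proof.
have -> : (0 : gform (gfun Y) 0 h)
    = fcomb 0 0 (0 : gform (gfun Y) 0 h) (0 : gform (gfun Y) 0 h).
  by rewrite /= !scale0r addr0.
by rewrite ev_lin // !scale0r addr0.
Qed.

Lemma incl_clie F G H g (X : vect S F g) x : fcar H `<=` fcar G ->
  Defs.incl S F G H (clie X x) = clie X (Defs.incl S F G H x).
Proof.
move=> HG; have [_ dI] := incl_pullback S F HG.
by rewrite /clie linearD linearZ /= !incl_iota // !dI incl_iota.
Qed.

Lemma is_form_fd0 (A : galg R) h (f : A h) : is_form (fd (f : gform A 0 h)).
Proof.
split=> // a b g k l eg ek el em x X Z W XZ /=.
by rewrite !scale1r (XZ _ _ _ ek el em).
Qed.

Lemma clie_tgt F (X : gder (gfun Y) 1) h k (e : 1 + h = k) (f : gfun Y h) :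
  clie (tgt_lift S F X) (ev S F (f : gform (gfun Y) 0 h))
  = ev S F (dact X e f : gform (gfun Y) 0 k).
Proof.
have fP : is_form (f : gform (gfun Y) 0 h) by [].
rewrite clie1E (ciota_form0 _ (ev_deg S F fP)) linear0 subr0.
by rewrite -(ev_d S F fP) (tgt_liftP _ _ _ e (is_form_fd0 f)).
Qed.

(** On evaluated functions both lifts act as the source differential, which commutes with
    restriction; [ev_detects] turns this into relatedness. *)
Lemma src_lift_related F G : fcar G `<=` fcar F ->
  rho_related (src_lift S F) (src_lift S G).
Proof.
move=> GF; apply: ev_detects => // h f.
have fP : is_form (f : gform (gfun Y) 0 h) by [].
rewrite -ev_restr // -incl_clie // !src_liftP // incl_src // ev_restr //.
by rewrite rhox_src.
Qed.

Lemma tgt_lift_related (X : gder (gfun Y) 1) F G : fcar G `<=` fcar F ->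
  rho_related (tgt_lift S F X) (tgt_lift S G X).
Proof.
move=> GF; apply: ev_detects => // h f.
have fP : is_form (f : gform (gfun Y) 0 h) by [].
by rewrite -ev_restr // -incl_clie // !(clie_tgt _ X erefl) ev_restr.
Qed.

Lemma QF_related (t : hamiltonian_target Y n) F G : fcar G `<=` fcar F ->
  rho_related (QF S t F) (QF S t G).
Proof.
move=> GF x; rewrite /QF !ciotaDl linearD /= src_lift_related //.
by rewrite tgt_lift_related.
Qed.

(** [ev_detects] compares the bracket with the zero field along the identity restriction. *)
Lemma vbr_self0 F (X : vect S F 1) :
  (forall h (f : gfun Y h),
     clie X (clie X (ev S F (f : gform (gfun Y) 0 h))) = 0) ->
  vbr X X = 0.
Proof.
move=> XX0; apply: vect_faithful => x.
have detect := @ev_detects _ _ _ _ _ S F F _ (vbr X X) 0 (fun _ => id).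
rewrite -[x]rho_id detect ?ciota0l ?linear0 // => h f.
by rewrite !rhox_id clie0l clie_br1 XX0 addr0.
Qed.

Lemma vbr_src_lift F : vbr (src_lift S F) (src_lift S F) = 0.
Proof.
apply: vbr_self0 => h f; have fP : is_form (f : gform (gfun Y) 0 h) by [].
by rewrite src_liftP // clie_dsrc1 src_liftP // dsrc2 oppr0.
Qed.

(** On evaluated functions [QF] acts as [dsrc] plus the target field. Both square to zero, and the
    mixed terms cancel because the Lie derivative along [QF] anticommutes with [dsrc]. *)
Lemma vbr_QF (t : hamiltonian_target Y n) F : vbr (QF S t F) (QF S t F) = 0.
Proof.
have Qev h (f : gfun Y h) : clie (QF S t F) (ev S F (f : gform (gfun Y) 0 h))
    = dsrc (ev S F (f : gform (gfun Y) 0 h))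
      + ev S F (dact (t_Q t) (erefl (1 + h)) f : gform (gfun Y) 0 (1 + h)).
  have fP : is_form (f : gform (gfun Y) 0 h) by [].
  by rewrite clieDl src_liftP // (clie_tgt _ _ erefl).
apply: vbr_self0 => h f.
rewrite Qev clieD clie_dsrc1 !Qev t_cohomological ev0 addr0 linearD /=.
by rewrite dsrc2 add0r addNr.
Qed.

Lemma QF_square (t : hamiltonian_target Y n) F (x : fields S F) :
  clie (QF S t F) (clie (QF S t F) x) = 0.
Proof.
have /eqP : clie (vbr (QF S t F) (QF S t F)) x = 0 by rewrite vbr_QF clie0l.
by rewrite clie_br1 -mulr2n -scaler_nat scaler_eq0 pnatr_eq0 => /eqP.
Qed.

Notation iotaD F := (ciota (src_lift S F)).

Lemma clie_iter_src F k (x : fsource S F F) :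
  clie (src_lift S F) (iter k (iotaD F) x) = iter k (iotaD F) (clie (src_lift S F) x).
Proof.
by elim: k => //= k <-; rewrite clie_iota1 vbr_src_lift ciota0l addr0.
Qed.

(** Each of the [k] contractions leaves one Lie derivative when [cdel] passes it, and this commutes
    with the other contractions. For [k = 0] the truncated predecessor is multiplied by 0. *)
Lemma iter_src_cdel F k (x : fsource S F F) :
  iter k (iotaD F) (cdel x) = cdel (iter k (iotaD F) x)
    + k%:R *: iter k.-1 (iotaD F) (clie (src_lift S F) x).
Proof.
elim: k => [|k IH]; first by rewrite scale0r addr0.
have step : iotaD F (cdel (iter k (iotaD F) x))
    = cdel (iter k.+1 (iotaD F) x) + iter k (iotaD F) (clie (src_lift S F) x).
  by rewrite -clie_iter_src clie1E addrC subrK.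
rewrite iterS IH linearD linearZ /= step -addrA; congr (_ + _).
case: k {IH step} => [|k]; first by rewrite scale0r addr0 scale1r.
by rewrite -[in X in X + _ = _](scale1r (iter _ _ _)) -scalerDl -[k.+2]add1n natrD.
Qed.

Lemma iter_src_dsrc F k (x : fsource S F F) :
  iter k (iotaD F) (dsrc x) = dsrc (iter k (iotaD F) x).
Proof. by elim: k => //= k ->; rewrite dsrc_iota1. Qed.

Lemma iter_src_incl F G k (x : fsource S F F) : fcar G `<=` fcar F ->
  Defs.incl S F F G (iter k (iotaD F) x) = iter k (iotaD F) (Defs.incl S F F G x).
Proof. by move=> GF; elim: k => //= k <-; rewrite incl_iota. Qed.

Lemma iter_src_rho F G k (x : fields S G) : fcar G `<=` fcar F ->
  iter k (iotaD F) (rho S F G x) = rho S F G (iter k (iotaD G) x).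
Proof. by move=> GF; elim: k => //= k ->; rewrite src_lift_related. Qed.

(** Fiber integration takes the two terms of [iter_src_cdel] to the two terms here: it commutes with
    [cdel] up to sign, and [src_liftP] makes the Lie derivative source-exact, so that Stokes'
    formula applies. *)
Lemma transgr_fd F p h (chi : gform (gfun Y) p h) k : is_form chi ->
  transgr S k F (fd chi) = (-1) ^+ fdim F *: cdel (transgr S k F chi)
    + k%:R *: \sum_(G \in fboundary F)
                incidence o F G *: rho S F G (transgr S k.-1 G chi).
Proof.
move=> chiP; rewrite /transgr ev_d // !iter_fint_iota1 iter_src_cdel linearD /=.
rewrite fint_cdel linearZ /= src_liftP // iter_src_dsrc stokes.
congr (_ + _ *: _); apply: eq_fsbigr => G /set_mem[GF _]; congr (_ *: _).
by rewrite iter_src_incl // ev_restr // -iter_fint_iota1 rhox_fint // iter_src_rho.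
Qed.

Lemma transgr_deg F p h (chi : gform (gfun Y) p h) k : is_form chi ->
  cbideg (p%:Z - k%:Z) (h - (fdim F)%:Z + k%:Z) (transgr S k F chi).
Proof.
move=> chiP; elim: k => [|k IH].
  by rewrite subr0 addr0; apply/fint_deg/ev_deg.
have := ciota_deg (src_lift S F) IH.
by rewrite -!addrA -opprD [k%:Z + 1]addrC -[1 + k%:Z]PoszD add1n.
Qed.

Lemma fdim_fcodim F : n%:Z - (fdim F)%:Z = (fcodim F)%:Z.
Proof. by rewrite /fdim -subzn ?fcodim_le // opprB addrC subrK. Qed.

Lemma fdim_fcodim_pred F : n%:Z - 1 - (fdim F)%:Z = (fcodim F)%:Z - 1.
Proof. by rewrite addrAC fdim_fcodim. Qed.

Lemma transgrD F p h a b (chi chi' : gform (gfun Y) p h) k :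
  is_form chi -> is_form chi' ->
  transgr S k F (fcomb a b chi chi')
  = a *: transgr S k F chi + b *: transgr S k F chi'.
Proof.
move=> chiP chi'P; rewrite /transgr !iter_fint_iota1 ev_lin //.
elim: k => [|k IH] /=; first by rewrite linearD !linearZ.
by rewrite -!fint_iota1 IH linearD !linearZ.
Qed.

(** The two-step restrictions to a face [H] all equal [rho S F H], so after exchanging the sums its
    coefficient is the sum in [incidence_cancel]. *)
Lemma fsum_incidence_rho2 F (eta : forall H : face M, fields S H) :
  \sum_(G \in fboundary F) incidence o F G *: rho S F G
     (\sum_(H \in fboundary G) incidence o G H *: rho S G H (eta H)) = 0.
Proof.
(* The inner range depends on [G]; extension by zero to a common finite range permits the
   exchange. *)
pose B := \bigcup_(G in fboundary F) fboundary G.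
have finB : finite_set B.
  by apply: bigcup_finite => [|G _]; apply: finite_fboundary.
pose T (G H : face M) : fields S F :=
  if H \in fboundary G then
    (incidence o F G * incidence o G H) *: rho S F G (rho S G H (eta H)) else 0.
transitivity (\sum_(G \in fboundary F) \sum_(H \in B) T G H).
  apply: eq_fsbigr => G /set_mem FG.
  rewrite linear_fsum ?scaler_fsumr; try exact: finite_fboundary.
  rewrite -fsbig_mkcondr.
  have -> : B `&` fboundary G = fboundary G.
    by apply/setIidPr => H GH; exists G.
  by apply: eq_fsbigr => H _; rewrite linearZ scalerA.
rewrite exchange_fsbig //; last exact: finite_fboundary.
apply: fsbig1 => H [G0 [G0F cG0] [HG0 cH]].
rewrite /T.
have -> : \sum_(G \in fboundary F) (if H \in fboundary G then
    (incidence o F G * incidence o G H) *: rho S F G (rho S G H (eta H)) else 0)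
  = \sum_(G \in [set G | prec H G /\ prec G F])
      (incidence o F G * incidence o G H) *: rho S F H (eta H).
  transitivity (\sum_(G \in fboundary F) if G \in [set G | prec H G] then
     (incidence o F G * incidence o G H) *: rho S F H (eta H) else 0).
    apply: eq_fsbigr => G /set_mem [GF _].
    have [HG|HG] := pselect (prec H G); last by rewrite !memNset.
    by rewrite !mem_set // rho_comp //; case: HG.
  rewrite -fsbig_mkcondr.
  have -> // : fboundary F `&` [set G | prec H G] = [set G | prec H G /\ prec G F].
  by apply/seteqP; split => G [].
rewrite -scaler_fsuml; last first.
  by apply: sub_finite_set (finite_fboundary F) => G [].
rewrite incidence_cancel ?scale0r //; first exact: subset_trans G0F.
by rewrite cH cG0.
Qed.

Lemma famD_cochain p (eta : families S) : cochain p eta -> cochain (p + 1) (famD eta).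
Proof.
move=> etaP F k; rewrite /famD; apply: cformD.
  by apply: cformZ; rewrite addrAC; apply: cdel_form.
case: k => [|k]; first exact: cform0.
apply: cform_fsum => [|G [GF _]]; first exact: finite_fboundary.
apply: cformZ; rewrite intS opprD addrA addrK.
apply: cform_linear (etaP G k) => g y yq; exists g.
by have [rho_deg _] := rho_pullback S GF; apply: rho_deg.
Qed.

(** The mixed terms cancel because the sign of [cdel] changes between [F] and its codimension-one
    faces; the pure boundary terms are [fsum_incidence_rho2]. *)
Lemma famD_famD (eta : families S) F k : famD (famD eta) F k = 0.
Proof.
have cdel_rho G x : fboundary F G -> cdel (rho S F G x) = rho S F G (cdel x).
  by move=> [GF _]; have [_ ->] := rho_pullback S GF.
have finF := finite_fboundary F.
have cdel_famD : cdel (famD eta F k) = if k is k'.+1 then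
    \sum_(G \in fboundary F) incidence o F G *: rho S F G (cdel (eta G k')) else 0.
  rewrite /famD linearD linearZ /= cdel2 scaler0 add0r.
  case: k => [|k]; first exact: linear0.
  rewrite linear_fsum //; apply: eq_fsbigr => G /set_mem FG.
  by rewrite linearZ /= cdel_rho.
rewrite {1}/famD cdel_famD.
case: k {cdel_famD} => [|k]; first by rewrite scaler0 addr0.
rewrite scaler_fsumr //.
have -> : \sum_(G \in fboundary F) incidence o F G *: rho S F G (famD eta G k)
  = \sum_(G \in fboundary F) incidence o F G *:
      rho S F G ((-1) ^+ fdim G *: cdel (eta G k))
  + \sum_(G \in fboundary F) incidence o F G *: rho S F G
     (if k is k'.+1 then
       \sum_(H \in fboundary G) incidence o G H *: rho S G H (eta H k') else 0).
  rewrite -fsbig_split //; apply: eq_fsbigr => G _.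
  by rewrite /= -scalerDr -linearD.
rewrite addrA -fsbig_split //= fsbig1 ?add0r; last first.
  move=> G FG; rewrite [rho S F G (_ *: _)]linearZ /= (fdimS FG) exprS mulN1r.
  by rewrite scaleNr !scalerA mulrC addNr.
case: k => [|k]; last exact: fsum_incidence_rho2.
by apply: fsbig1 => G _; rewrite linear0 scaler0.
Qed.

Lemma transgression_cochain p h (chi : gform (gfun Y) p h) :
  is_form chi -> cochain p%:Z (transgression S chi).
Proof. by move=> chiP F k; apply/cformZ/cbideg_cform/transgr_deg. Qed.

Lemma transgression_fd p h (chi : gform (gfun Y) p h) F k : is_form chi ->
  transgression S (fd chi) F k = famD (transgression S chi) F k.
Proof.
move=> chiP; rewrite /transgression /famD transgr_fd // scalerDr.
rewrite [cdel (_ *: _)]linearZ /= !scalerA mulrC; congr (_ + _).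
case: k => [|k]; first by rewrite mulr0 scale0r.
(* [k.+1] divided by its factorial is the inverse factorial of [k], the normalization of the
   boundary terms. *)
rewrite factS natrM invfM mulrAC mulVf ?pnatr_eq0 // mul1r scaler_fsumr; last first.
  exact: finite_fboundary.
by apply: eq_fsbigr => G _; rewrite [rho S F G (_ *: _)]linearZ /= !scalerA mulrC.
Qed.

(** * The data attached to the faces by the target, and closed faces *)

Section Target.
Variable t : hamiltonian_target Y n.

Lemma t_omega_form : is_form (t_omega t).
Proof. by have [] := t_symplectic t. Qed.

Lemma ciota_tgt_transgr F (X : gder (gfun Y) 1) p h k (e : 1 + h = k)
    (chi : gform (gfun Y) p.+1 h) : is_form chi ->
  ciota (tgt_lift S F X) (transgr S 0 F chi) = transgr S 0 F (fiota e X chi).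
Proof. by move=> chiP; rewrite /transgr /= fint_iota1 (tgt_liftP _ _ _ e). Qed.

(** The master equation provides some Hamiltonian field [X] of [t_Theta t] that annihilates it;
    nondegeneracy of the target form identifies its action with that of [t_Q t]. *)
Lemma t_QTheta : dact (t_Q t) (erefl (1 + n%:Z)) (t_Theta t) = 0.
Proof.
have [X Xham ->] := t_master t; have [_ _ nondeg _] := t_symplectic t.
by apply: (nondeg _ _ (deg_target n)); rewrite t_hamiltonian Xham.
Qed.

Lemma cdel_omegaF F : cdel (omegaF S t F) = 0.
Proof.
rewrite /omegaF /transgr /= fint_del t_exact ev_d ?cdel2 ?linear0 ?scaler0 //.
exact: t_alpha_form.
Qed.

Lemma omegaF_deg F : cbideg 2 ((fcodim F)%:Z - 1) (omegaF S t F).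
Proof.
by have := transgr_deg F 0 t_omega_form; rewrite subr0 addr0 fdim_fcodim_pred.
Qed.

Lemma alphaF_deg F : cbideg 1 ((fcodim F)%:Z - 1) (alphaF S t F).
Proof.
by have := transgr_deg F 0 (t_alpha_form t); rewrite subr0 addr0 fdim_fcodim_pred.
Qed.

Lemma actionF_deg F : cbideg 0 (fcodim F)%:Z (actionF S t F).
Proof.
apply: cbidegD.
  have := transgr_deg F 1 (t_alpha_form t).
  by rewrite subrr fdim_fcodim_pred subrK.
have ThetaP : is_form (t_Theta t : gform (gfun Y) 0 n%:Z) by [].
by have := transgr_deg F 0 ThetaP; rewrite subr0 addr0 fdim_fcodim.
Qed.

Lemma ciota_tgt_omegaF F : ciota (tgt_lift S F (t_Q t)) (omegaF S t F)
  = transgr S 0 F (fd (t_Theta t : gform (gfun Y) 0 n%:Z)).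
Proof.
by rewrite -t_hamiltonian -ciota_tgt_transgr //; apply: t_omega_form.
Qed.

Lemma ciota_QF_omegaF F : ciota (QF S t F) (omegaF S t F)
  = (-1) ^+ fdim F *: cdel (actionF S t F)
    + \sum_(G \in fboundary F) incidence o F G *: rho S F G (alphaF S t G).
Proof.
have ThetaP : is_form (t_Theta t : gform (gfun Y) 0 n%:Z) by [].
rewrite ciotaDl ciota_tgt_omegaF transgr_fd // scale0r addr0.
have -> : ciota (src_lift S F) (omegaF S t F) = transgr S 1 F (fd (t_alpha t)).
  by rewrite /omegaF t_exact.
rewrite transgr_fd; last exact: t_alpha_form.
by rewrite scale1r addrAC -scalerDr -linearD.
Qed.

Section ClosedFace.
Variable F : face M.
Hypothesis F_closed : closed_face F.

Lemma transgr_fd_closed p h (chi : gform (gfun Y) p h) k :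
  is_form chi -> transgr S k F (fd chi) = (-1) ^+ fdim F *: cdel (transgr S k F chi).
Proof.
move=> chiP; rewrite transgr_fd //.
have -> : fboundary F = set0 by rewrite -subset0 => G /F_closed.
by rewrite fsbig_set0 scaler0 addr0.
Qed.

(** The transgression of [chi] has negative form degree [p - k]. *)
Lemma transgr_fd_closed0 p h (chi : gform (gfun Y) p h) k :
  is_form chi -> (p < k)%N -> transgr S k F (fd chi) = 0.
Proof.
move=> chiP pk; rewrite transgr_fd_closed // (cbideg_neg _ (transgr_deg F k chiP)).
  by rewrite linear0 scaler0.
by rewrite subr_lt0.
Qed.

Lemma ciota_QF2_omegaF : ciota (QF S t F) (ciota (QF S t F) (omegaF S t F)) = 0.
Proof.
have ThetaP : is_form (t_Theta t : gform (gfun Y) 0 n%:Z) by [].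
have DD0 : ciota (src_lift S F) (ciota (src_lift S F) (omegaF S t F)) = 0.
  rewrite -[LHS]/(transgr S 2 F (t_omega t)) t_exact transgr_fd_closed0 //.
  exact: t_alpha_form.
have DQ0 : ciota (src_lift S F) (ciota (tgt_lift S F (t_Q t)) (omegaF S t F)) = 0.
  rewrite ciota_tgt_omegaF -[LHS]/(transgr S 1 F (fd _)).
  exact: transgr_fd_closed0.
(* Of the four double contractions, [ciotaC] reduces one mixed term to the other, and the pure
   target term is the transgression of the derivative of [t_Theta t] along [t_Q t]. *)
rewrite !ciotaDl !linearD /= DD0 DQ0 ciotaC DQ0 scaler0 !add0r ciota_tgt_omegaF.
rewrite (ciota_tgt_transgr _ _ erefl); last exact: is_form_fd0.
by rewrite /fiota /= t_QTheta /transgr /= ev0 linear0.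
Qed.

Lemma closed_strict_BFV : weakly_nondegenerate (omegaF S t F) ->
  strict_BFV (fcodim F) (omegaF S t F) (QF S t F) (actionF S t F).
Proof.
move=> nondeg.
have Qham : ciota (QF S t F) (omegaF S t F)
    = (-1) ^+ fdim F *: cdel (actionF S t F).
  rewrite ciota_QF_omegaF.
  have -> : fboundary F = set0 by rewrite -subset0 => G /F_closed.
  by rewrite fsbig_set0 addr0.
have Sham : cdel (actionF S t F)
    = (-1) ^+ fdim F *: ciota (QF S t F) (omegaF S t F).
  by rewrite Qham scalerA -expr2 sqrr_sign scale1r.
split=> //; [split; [exact: omegaF_deg|exact: cdel_omegaF]|exact: actionF_deg
            |exact: QF_square|split=> //].
(* The sign undoes the one in the Hamiltonian condition for [QF], so that this is the Hamiltonian
   field of the action itself. *)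
exists ((-1) ^+ fdim F *: QF S t F); first by rewrite ciotaZl Sham.
rewrite clieZl clie1E (ciota_form0 _ (actionF_deg F)) linear0 subr0 Sham.
by rewrite linearZ /= ciota_QF2_omegaF !scaler0.
Qed.
End ClosedFace.
End Target.
End Forms.

Theorem theorem1p1 (R : realType) (n : nat) (M : manifold_with_faces R n)
    (o : forall F : face M, orientation F)
    (Y : graded_manifold R) (t : hamiltonian_target Y n)
    (S : mapping_spaces o Y) :
  (* (i) *)
  (forall F : face M,
     [/\ cdel (omegaF S t F) = 0,
         cbideg 2 ((fcodim F)%:Z - 1) (omegaF S t F),
         cbideg 1 ((fcodim F)%:Z - 1) (alphaF S t F) &
         cbideg 0 (fcodim F)%:Z (actionF S t F)])
  /\
  (* (ii) *)
  (forall F : face M,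
     ciota (QF S t F) (omegaF S t F)
     = (-1) ^+ fdim F *: cdel (actionF S t F)
       + \sum_(G \in fboundary F) incidence o F G *: rho S F G (alphaF S t G))
  /\
  (* (iii) *)
  (forall F G : face M, prec G F -> rho_related (QF S t F) (QF S t G))
  /\
  (* (iv) *)
  [/\ forall p eta, cochain (S := S) p eta -> cochain (p + 1) (famD eta),
      forall p eta, cochain (S := S) p eta ->
        forall F k, famD (famD eta) F k = 0,
      forall p h (chi : gform (gfun Y) p h), is_form chi ->
        cochain p%:Z (transgression S chi),
      forall p h a b (chi chi' : gform (gfun Y) p h), is_form chi -> is_form chi' ->
        forall F k, transgression S (fcomb a b chi chi') F k
          = a *: transgression S chi F k + b *: transgression S chi' F k &
      forall p h (chi : gform (gfun Y) p h), is_form chi ->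
        forall F k, transgression S (fd chi) F k = famD (transgression S chi) F k]
  /\
  (* (v) *)
  (forall F H : face M, fcar H `<=` fcar F -> fcodim H = (fcodim F).+2 ->
     \sum_(G \in [set G | prec H G /\ prec G F])
        (incidence o F G * incidence o G H) *: rho S F G (rho S G H (alphaF S t H))
     = 0)
  /\
  (* (vi) *)
  (forall F : face M, closed_face F -> weakly_nondegenerate (omegaF S t F) ->
     strict_BFV (fcodim F) (omegaF S t F) (QF S t F) (actionF S t F)).
Proof.
split.
  move=> F; split; [exact: cdel_omegaF|exact: omegaF_deg|exact: alphaF_deg
                   |exact: actionF_deg].
split; first by move=> F; apply: ciota_QF_omegaF.
split; first by move=> F G [GF _]; apply: QF_related.
split.
  split.
  - exact: famD_cochain.
  - by move=> p eta _; apply: famD_famD.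
  - exact: transgression_cochain.
  - move=> p h a b chi chi' chiP chi'P F k; rewrite /transgression transgrD //.
    by rewrite scalerDr !scalerA ![_ * a]mulrC ![_ * b]mulrC.
  - by move=> p h chi chiP F k; apply: transgression_fd.
split; last exact: closed_strict_BFV.
move=> F H HF cH.
transitivity (\sum_(G \in [set G | prec H G /\ prec G F])
   (incidence o F G * incidence o G H) *: rho S F H (alphaF S t H)).
  by apply: eq_fsbigr => G /set_mem[[HG _] [GF _]]; rewrite rho_comp.
rewrite -scaler_fsuml ?incidence_cancel ?scale0r //.
by apply: sub_finite_set (finite_fboundary F) => G [].
Qed.
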